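(* Let $k\ge 4$ and let $R$ be an arbitrary $k$-vertex tournament whose edges are colored with the $\binom k2$ distinct colors from $\binom{[k]}2$. Then $i(R)=\frac{k!}{k^k-k}$.
   Context: For an $s$-vertex tournament $H$ whose edges are colored from $\binom{[k]}2$, $i(R;H)$ denotes the number of copies of $R$ in $H$, i.e. the number of $k$-sets $K$ of vertices such that $H[K]$ is isomorphic to $R$ preserving orientations and colors. The inducibility of $R$ is $i(R)=\lim_{s\to\infty}\max_{|V(H)|=s} i(R;H)/\binom sk$, the maximum over all $s$-vertex $\binom{[k]}2$-edge-colored tournaments $H$. *)

(* Defs.v *)
From HB Require Import structures.
From mathcomp Require Import all_boot all_order all_algebra.
From mathcomp Require Import all_classical all_reals all_analysis.
Set Implicit Arguments. Unset Strict Implicit. Unset Printing Implicit Defensive.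
Import Order.TTheory GRing.Theory Num.Theory.

(* An n-vertex tournament with edges coloured from binom([k],2), vertex set 'I_n.
   Component 1: orientation, (x,y) = true means edge x -> y.
   Component 2: colour of the edge {x,y}, a 2-element subset of 'I_k
   (stored symmetrically).  Diagonal entries are normalised (false / set0). *)
Definition ctour (n k : nat) :=
  ({ffun 'I_n * 'I_n -> bool} * {ffun 'I_n * 'I_n -> {set 'I_k}})%type.

Definition is_ctour n k (T : ctour n k) : bool :=
  [forall x : 'I_n, forall y : 'I_n,
     if x == y then ~~ T.1 (x, y) && (T.2 (x, y) == finset.set0)
     else [&& T.1 (x, y) != T.1 (y, x), T.2 (x, y) == T.2 (y, x)
            & #|T.2 (x, y)| == 2]].

Definition rainbow k (R : ctour k k) : Prop :=
  forall i j i' j' : 'I_k, i != j -> i' != j' ->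
    R.2 (i, j) = R.2 (i', j') -> [set i; j] = [set i'; j'].

Definition is_copy k s (R : ctour k k) (H : ctour s k) (K : {set 'I_s}) : bool :=
  (#|K| == k) &&
  [exists f : {ffun 'I_k -> 'I_s},
     [&& injectiveb f, f @: setT == K &
      [forall i : 'I_k, forall j : 'I_k, (i != j) ==>
         (H.1 (f i, f j) == R.1 (i, j)) && (H.2 (f i, f j) == R.2 (i, j))]]].

Definition ncopies k s (R : ctour k k) (H : ctour s k) : nat :=
  #|[set K : {set 'I_s} | is_copy R H K]|.

Definition maxdens (rT : realType) k (R : ctour k k) (s : nat) : rT :=
  \big[Num.max/0%R]_(H : ctour s k | is_ctour H)
     ((ncopies R H)%:R / ('C(s, k))%:R)%R.

(* Main.v *)
Require Import Defs.
From HB Require Import structures.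
From mathcomp Require Import all_boot all_order all_algebra.
From mathcomp Require Import ring lra zify.
Set Implicit Arguments. Unset Strict Implicit. Unset Printing Implicit Defensive.
Import Order.TTheory GRing.Theory Num.Theory.

(* Since the colours of R are distinct, the colour and the orientation of an
   edge xy of H determine the roles of x and y in every copy of R through xy.

   Upper bound: (k^k - k) * (number of copies) <= n^k, by induction on n.
   A vertex in few copies is deleted.  If every vertex is in many copies, then
   AM-GM shows that each vertex x has a dominant role r(x), which it plays on
   all but a fraction of about 1/k of its edges.  Partition the vertices by
   their dominant roles.  Copies inside a part are counted by induction,
   copies in which every vertex plays its dominant role are at most the
   transversals of the partition, and any other copy contains at least k - 2
   edges between parts which are not labelled by the dominant roles of their
   ends.  Such an edge lies in few of these mixed copies, and it destroys all
   the transversals through it, which are more numerous unless the part sizes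
   are so unbalanced that the bound holds anyway.

   Lower bound: the iterated blow-up of R, encoded by base-k digits. *)

(** * Inequalities between means *)

Section RealInequalities.
Local Open Scope ring_scope.
Variable R : realFieldType.
Implicit Types (a b e mu x y : R).

(** This is AM-GM for the shifted products. As [c |-> f i + c] permutes the indices, each [i]
    contributes every [x j] once to their product over [c], which is therefore
    [(\prod_i x i) ^+ k.+1]. *)
Lemma prodr_le_cyclic_sum k (f : {ffun 'I_k.+1 -> 'I_k.+1}) (x : 'I_k.+1 -> R) :
  (forall i, 0 <= x i) ->
  k.+1%:R * \prod_i x i <= \sum_(c < k.+1) \prod_i x (f i + c).
Proof.
move=> x0; set S := \sum_c _; set P := \prod_i x i.
have y0 (c : 'I_k.+1) : 0 <= \prod_i x (f i + c) by exact: prodr_ge0.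
have := @leif_AGM R _ predT (fun c : 'I_k.+1 => \prod_i x (f i + c)) (fun c _ => y0 c).
rewrite cardT size_enum_ord => -[+ _].
have -> : \prod_(c in predT) \prod_i x (f i + c) = P ^+ k.+1.
  rewrite exchange_big /= (eq_bigr (fun=> P)); first by rewrite prodr_const card_ord.
  move=> i _; rewrite /P [RHS](reindex (fun c => f i + c)) //=.
  by exists (fun c => c - f i) => c _; rewrite ?subrKC // addrAC subrr add0r.
rewrite ler_pXn2r // ?nnegrE ?prodr_ge0 // ?divr_ge0 ?sumr_ge0 ?ler0n //.
by rewrite ler_pdivlMr ?ltr0n // mulrC.
Qed.

(* Among the k^k monomials of the expanded power, those which are not pure
   powers are grouped into orbits of the cyclic shift of the indices; on each
   orbit the inequality is the one of arithmetic and geometric means. *)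
Lemma sum_expn_AGM k (x : 'I_k -> R) :
  (0 < k)%N -> (forall i, 0 <= x i) ->
  (k ^ k - k)%:R * \prod_i x i + \sum_i x i ^+ k <= (\sum_i x i) ^+ k.
Proof.
case: k x => // k x _ x0.
have -> : (\sum_i x i) ^+ k.+1 = \sum_(f : {ffun 'I_k.+1 -> 'I_k.+1}) \prod_i x (f i).
  by rewrite -(bigA_distr_bigA (fun _ j => x j)) /= prodr_const card_ord.
pose cst (c : 'I_k.+1) : {ffun 'I_k.+1 -> 'I_k.+1} := [ffun=> c].
have cst_inj : injective cst by move=> c d /ffunP /(_ ord0); rewrite !ffunE.
pose C := [set cst c | c in 'I_k.+1].
rewrite (bigID (mem C)) /= big_imset /=; last by move=> ? ? _ _; exact: cst_inj.
rewrite [X in _ <= X + _](eq_bigr (fun c => x c ^+ k.+1)); last first.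
  by move=> c _; rewrite (eq_bigr (fun=> x c)) ?prodr_const ?card_ord // => i _; rewrite ffunE.
rewrite addrC lerD2l.
pose sh (c : 'I_k.+1) (f : {ffun 'I_k.+1 -> 'I_k.+1}) := [ffun i => f i + c].
have shC c f : (sh c f \in C) = (f \in C).
  apply/imsetP/imsetP => -[d _ /ffunP fE].
    exists (d - c) => //; apply/ffunP => i; move: (fE i).
    by rewrite !ffunE => <-; rewrite addrK.
  by exists (d + c) => //; apply/ffunP => i; rewrite !ffunE fE ffunE.
have shK c : cancel (sh c) (sh (- c)) by move=> f; apply/ffunP => i; rewrite !ffunE addrK.
have shKV c : cancel (sh (- c)) (sh c) by move=> f; apply/ffunP => i; rewrite !ffunE subrK.
have -> : (k.+1 ^ k.+1 - k.+1 = #|[predC C]|)%N.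
  have := cardC C; rewrite card_ffun card_ord card_imset // card_ord => <-.
  by rewrite addKn.
rewrite -(ler_pM2l (ltr0Sn R k)).
have -> : k.+1%:R * \sum_(f | f \notin C) \prod_i x (f i) =
  \sum_(f | f \notin C) \sum_(c < k.+1) \prod_i x (f i + c).
  rewrite exchange_big /=; set S := \sum_(f | _) _.
  have <- : \sum_(c < k.+1) S = k.+1%:R * S by rewrite sumr_const card_ord mulr_natl.
  apply: eq_big => // c _; rewrite /S.
  rewrite (reindex (sh c)) /=; last first.
    by exists (sh (- c)) => f _; [exact: shK|exact: shKV].
  apply: eq_big => [f|f _]; first by rewrite shC.
  by apply: eq_bigr => i _; rewrite ffunE.
rewrite mulrCA mulr_natl -sumr_const; apply: ler_sum => f _.
exact: prodr_le_cyclic_sum.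
Qed.

(** Convexity of powers. The induction carries the differences along, because [E1] and [E2] express
    the sum and the difference of the next powers through both. *)
Lemma powsum_le m a b (c d : R) : 0 <= d -> d <= b -> b <= a -> a + b = c + d ->
  a ^+ m + b ^+ m <= c ^+ m + d ^+ m.
Proof.
move=> d0 db ba e.
suff [] : [/\ a ^+ m + b ^+ m <= c ^+ m + d ^+ m, a ^+ m - b ^+ m <= c ^+ m - d ^+ m,
  0 <= a ^+ m + b ^+ m & 0 <= a ^+ m - b ^+ m] by [].
elim: m => [|m [h1 h2 h3 h4]]; first by rewrite !expr0; split; lra.
have s0 : 0 <= a + b by lra.
have E1 x y : x ^+ m.+1 + y ^+ m.+1 =
  ((x + y) * (x ^+ m + y ^+ m) + (x - y) * (x ^+ m - y ^+ m)) / 2 by rewrite !exprS; lra.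
have E2 x y : x ^+ m.+1 - y ^+ m.+1 =
  ((x + y) * (x ^+ m - y ^+ m) + (x - y) * (x ^+ m + y ^+ m)) / 2 by rewrite !exprS; lra.
have d1 : 0 <= a - b by lra.
have d2 : a - b <= c - d by lra.
rewrite !E1 !E2 -e; split.
- by rewrite ler_pM2r ?invr_gt0 // lerD // ?ler_wpM2l // ler_pM.
- by rewrite ler_pM2r ?invr_gt0 // lerD // ?ler_wpM2l // ler_pM.
- by rewrite divr_ge0 // addr_ge0 // mulr_ge0.
- by rewrite divr_ge0 // addr_ge0 // mulr_ge0.
Qed.

Lemma sum_expn_le_max (I : finType) (A : {pred I}) (p : I -> R) m b :
  (forall i, 0 <= p i) -> (forall i, i \in A -> p i <= b) ->
  \sum_(i in A) p i ^+ m.+1 <= b ^+ m * \sum_(i in A) p i.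
Proof.
move=> p0 pb; rewrite mulr_sumr; apply: ler_sum => i iA.
by rewrite exprSr ler_wpM2r // lerXn2r ?nnegrE ?(le_trans (p0 i)) ?pb.
Qed.

(** Suppose that no summand exceeds [(1 - e) * N]. If the largest one is at least [N / 2], the
    others count for no more than a single summand [N - p i0], and [powsum_le] applies; otherwise
    all are at most [N / 2], and the power sum is at most that of two halves. *)
Lemma dominant_summand (I : finType) (p : I -> R) m N e :
  (forall i, 0 <= p i) -> 0 <= N -> 0 <= e <= 1 / 2 -> \sum_i p i <= N ->
  ((1 - e) ^+ m.+1 + e ^+ m.+1) * N ^+ m.+1 < \sum_i p i ^+ m.+1 ->
  exists i, (1 - e) * N < p i.
Proof.
move=> p0 N0 /andP[e0 e1] pN big.
apply/existsP; apply: contraTT big; rewrite negb_exists => /forallP small.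
rewrite -leNgt mulrDl -!exprMn.
have eN0 : 0 <= e * N by rewrite mulr_ge0.
have eN : e * N <= N / 2 by rewrite mulrC ler_wpM2l //; lra.
case: (pickP (@predT I)) => [i1 _|I0]; last first.
  rewrite big_pred0 //; apply: addr_ge0; rewrite exprn_ge0 //; lra.
have [i0 _ imax] := @arg_maxP _ _ _ i1 predT p isT.
have {}small i : p i <= (1 - e) * N by move: (small i); rewrite -leNgt.
have [p2|p2] := leP (N / 2) (p i0).
  apply: le_trans (@powsum_le m.+1 (p i0) (N - p i0) _ _ _ _ _ _); try lra.
    rewrite (bigD1 i0) //= lerD2l.
    have rest : \sum_(i | i != i0) p i <= N - p i0.
      by move: pN; rewrite (bigD1 i0) //=; lra.
    have r0 : 0 <= N - p i0 by apply: le_trans rest; exact: sumr_ge0.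
    apply: le_trans (_ : (N - p i0) ^+ m * \sum_(i | i != i0) p i <= _).
      apply: (@sum_expn_le_max _ [pred i | i != i0]) => // i ii0; apply: le_trans rest.
      rewrite (bigD1 i) //= lerDl; exact: sumr_ge0.
    by rewrite exprSr ler_wpM2l // exprn_ge0.
  by move: (small i0); lra.
apply: le_trans (@powsum_le m.+1 (N / 2) (N / 2) _ _ _ _ _ _); try lra.
apply: le_trans (@sum_expn_le_max _ predT p m (N / 2) p0 _) _.
  by move=> i _; apply: le_trans (imax i isT) _; lra.
have -> : (N / 2) ^+ m.+1 + (N / 2) ^+ m.+1 = (N / 2) ^+ m * N by rewrite exprSr; lra.
by rewrite ler_wpM2l // exprn_ge0 //; lra.
Qed.

Lemma bernoulli_ler m x : 0 <= x -> 1 + m%:R * x <= (1 + x) ^+ m.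
Proof.
move=> x0; elim: m => [|m IH]; first by rewrite expr0; lra.
rewrite exprS mulrS; apply: le_trans (_ : (1 + x) * (1 + m%:R * x) <= _).
  have : 0 <= m%:R * x * x by rewrite !mulr_ge0.
  lra.
by rewrite ler_wpM2l //; lra.
Qed.

End RealInequalities.

(** * Numerical estimates *)

Section NumericalBounds.
Local Open Scope ring_scope.
Variable R : realFieldType.

(* Throughout, [k = m + 2].  In a minimal counterexample on [n] vertices a
   vertex plays non-dominant roles on at most [eps * n] edges; the factor
   [103 / 100] leaves room down to [k = 4].  If [e * n ^ 2] pairs join two
   given parts with a wrong label, for the worst choice of these parts, then
   the mixed copies number at most [e * edge_coef * n ^ k] and at most
   [vertex_coef * n ^ k]. *)
Definition eps (m : nat) : R := 103%:R / 100%:R / m.+2%:R.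
Definition edge_coef (m : nat) : R :=
  m.+2%:R * m.+1%:R / 2 / m%:R * (eps m / m%:R) ^+ m.
Definition vertex_coef (m : nat) : R := (eps m / m.+1%:R) ^+ m.+1.

Lemma eps_gt0 m : 0 < eps m.
Proof. by rewrite /eps !divr_gt0 ?ltr0n. Qed.

Lemma eps_le m : (2 <= m)%N -> eps m <= 103%:R / 400%:R.
Proof.
move=> m2; rewrite /eps ler_pdivrMr ?ltr0n //.
have : (4%:R : R) <= m.+2%:R by rewrite ler_nat.
lra.
Qed.

Lemma expn_self_gt m : (m.+2 < m.+2 ^ m.+2)%N.
Proof. exact: ltn_expl. Qed.

(** This fixes [eps]: through [dominant_summand], a vertex in more than
    [k * (n - 1) ^ (k - 1) / (k ^ k - k)] copies gets a dominant role. As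
    [(1 - eps) * k = k - 1 - 3/100], for [k >= 5] division by [(k - 1) ^ (k - 1)] turns the main
    term into [(1 - t) ^ (k - 1)] with [(k - 1) * t = 3/100], which is at most [100/103] by
    Bernoulli. *)
Lemma dominance_threshold m : (2 <= m)%N ->
  ((1 - eps m) ^+ m.+1 + eps m ^+ m.+1) * (m.+2 ^ m.+2 - m.+2)%:R
    <= m.+1%:R ^+ m.+1 * m.+2%:R.
Proof.
case: m => [|[|[|m]]] // _.
  (* For [k = 4] the exact value 252 matters: the inequality fails with [4 ^ 4] in its place. *)
  have -> : (4 ^ 4 - 4 = 252)%N by [].
  rewrite /eps !exprS !expr0; lra.
set n := m.+3; have K0 : (0 : R) < n.+2%:R by rewrite ltr0n.
have e0 := eps_gt0 n; have e1 := @eps_le n isT.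
have Ke : eps n * n.+2%:R = 103%:R / 100%:R by rewrite /eps divfK // gt_eqF.
apply: le_trans (_ : ((1 - eps n) ^+ n.+1 + eps n ^+ n.+1) * n.+2%:R ^+ n.+2 <= _).
  apply: ler_wpM2l; last by rewrite -natrX ler_nat leq_subr.
  by apply: addr_ge0; rewrite exprn_ge0 //; lra.
rewrite (exprSr n.+2%:R) mulrA ler_pM2r // mulrDl -!exprMn Ke.
have z0 : (0 : R) < n.+1%:R by rewrite ltr0n.
have z4 : (4%:R : R) <= n.+1%:R by rewrite ler_nat.
pose w : R := n.+1%:R^-1.
have w0 : 0 < w by rewrite invr_gt0.
have w4 : w <= 4%:R^-1 by rewrite lef_pV2 // ?posrE ?ltr0n.
have wz : n.+1%:R * w = 1 by rewrite mulfV // gt_eqF.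
have -> : (1 - eps n) * n.+2%:R = (1 - 3%:R / 100%:R * w) * n.+1%:R.
  by move: Ke wz; rewrite -(natr1 n.+1) => ? ?; lra.
have -> : 103%:R / 100%:R = (103%:R / 100%:R * w) * n.+1%:R :> R.
  by move: wz => ?; lra.
have E (v : R) : (v * n.+1%:R) ^+ n.+1 = v ^+ n.+1 * n.+1%:R ^+ n.+1 by rewrite exprMn.
rewrite !E -mulrDl -[leRHS]mul1r; apply: ler_wpM2r; first by rewrite exprn_ge0 // ltW.
set t := 3%:R / 100%:R * w.
have t0 : 0 <= t by rewrite /t; lra.
have t1 : t <= 1 by rewrite /t; lra.
have A1 : (1 - t) ^+ n.+1 <= 100%:R / 103%:R.
  have : (1 - t) ^+ n.+1 * (1 + t) ^+ n.+1 <= 1.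
    by rewrite -exprMn exprn_ile1 //; nra.
  have := @bernoulli_ler R n.+1 t t0.
  have -> : n.+1%:R * t = 3%:R / 100%:R by rewrite /t mulrCA wz mulr1.
  have : 0 <= (1 - t) ^+ n.+1 by rewrite exprn_ge0 //; lra.
  move: (_ ^+ _) (_ ^+ _) => p q; nra.
have A2 : (103%:R / 100%:R * w) ^+ n.+1 <= (103%:R / 400%:R) ^+ 4.
  apply: le_trans (_ : (103%:R / 400%:R) ^+ n.+1 <= _).
    by rewrite lerXn2r ?nnegrE //; lra.
  by rewrite ler_wiXn2l //; lra.
apply: le_trans (lerD A1 A2) _.
rewrite !exprS expr0; lra.
Qed.

(** With [k ^ k - k] weakened to [k ^ k], the three summands are at most 845, 23 and 79
    thousandths. *)
Lemma coef_bound m : (3 <= m)%N ->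
  (m.+2 ^ m.+2 - m.+2)%:R * (edge_coef m / 4 + vertex_coef m)
    + (53%:R / 100%:R) ^+ m.+1 <= 1.
Proof.
move=> m3.
have K0 : (0 : R) < m.+2%:R by rewrite ltr0n.
have y0 : (0 : R) < m%:R by rewrite ltr0n; lia.
have z0 : (0 : R) < m.+1%:R by rewrite ltr0n.
have z4 : (4%:R : R) <= m.+1%:R by rewrite ler_nat.
have c0 : 0 <= edge_coef m / 4 + vertex_coef m.
  have e0 := ltW (eps_gt0 m).
  apply: addr_ge0; last by rewrite exprn_ge0 // divr_ge0 ?ler0n.
  rewrite divr_ge0 // mulr_ge0 ?exprn_ge0 ?divr_ge0 ?ler0n //.
  by rewrite mulr_ge0 ?ler0n.
have Mle : (m.+2 ^ m.+2 - m.+2)%:R <= m.+2%:R ^+ m.+2 :> R.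
  by rewrite -natrX ler_nat leq_subr.
have B1 : m.+2%:R ^+ m.+2 * (edge_coef m / 4) <= 845%:R / 1000%:R.
  have -> : m.+2%:R ^+ m.+2 * (edge_coef m / 4) =
    m.+2%:R ^+ 3 * m.+1%:R / (8%:R * m%:R) * (103%:R / 100%:R / m%:R) ^+ m.
    have -> : 103%:R / 100%:R / m%:R = eps m / m%:R * m.+2%:R :> R.
      by rewrite /eps; move: K0 y0; move: (m.+2%:R) m%:R => K y K0 y0; field; rewrite !gt_eqF.
    rewrite exprMn !exprS /edge_coef; move: K0 y0; move: (eps m / _) (m.+2%:R) m.+1%:R.
    move=> e K z K0; move: (e ^+ m) (K ^+ m) m%:R => E F y y0.
    by rewrite expr0; field; rewrite gt_eqF.
  (* The case [k = 5] is computed. For larger [k] the exponent [m] is lowered to 4, and what remains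
     increases with [u = 1 / m <= 1 / 4]. *)
  move: m3 y0 {c0 z4 K0 z0 Mle}; rewrite leq_eqVlt => /orP[/eqP <- _|m4 y0].
    rewrite !exprS expr0; lra.
  pose u : R := m%:R^-1.
  have u0 : 0 < u by rewrite invr_gt0.
  have u4 : u <= 4%:R^-1 by rewrite lef_pV2 ?posrE // ler_nat.
  apply: le_trans (_ : m.+2%:R ^+ 3 * m.+1%:R / (8%:R * m%:R) * (103%:R / 100%:R * u) ^+ 4 <= _).
    rewrite ler_wpM2l ?divr_ge0 ?mulr_ge0 ?exprn_ge0 ?ler0n //.
    rewrite ler_wiXn2l // -/u; lra.
  have -> : m.+2%:R ^+ 3 * m.+1%:R / (8%:R * m%:R) * (103%:R / 100%:R * u) ^+ 4 =
    (103%:R / 100%:R) ^+ 4 / 8%:R * ((1 + 2 * u) ^+ 3 * (1 + u) * u).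
    rewrite /u -(natr1 m.+1) -(natr1 m).
    by rewrite !exprS !expr0; field; rewrite gt_eqF.
  apply: le_trans (_ : (103%:R / 100%:R) ^+ 4 / 8%:R *
    ((3%:R / 2%:R) ^+ 3 * (5%:R / 4%:R) * 4%:R^-1) <= _); last by rewrite !exprS expr0; lra.
  apply: ler_wpM2l; first by rewrite divr_ge0 // exprn_ge0 // divr_ge0.
  apply: ler_pM => //.
  - by rewrite mulr_ge0 ?exprn_ge0 //; lra.
  - exact: ltW.
  - apply: ler_pM; rewrite ?exprn_ge0 //; try lra.
    by rewrite lerXn2r ?nnegrE //; lra.
have B2 : m.+2%:R ^+ m.+2 * vertex_coef m <= 23%:R / 1000%:R.
  pose w : R := m.+1%:R^-1.
  have w0 : 0 < w by rewrite invr_gt0.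
  have w4 : w <= 4%:R^-1 by rewrite lef_pV2 // ?posrE ?ltr0n.
  have -> : m.+2%:R ^+ m.+2 * vertex_coef m = m.+2%:R * (103%:R / 100%:R * w) ^+ m.+1.
    have -> : 103%:R / 100%:R * w = eps m / m.+1%:R * m.+2%:R :> R.
      by rewrite /eps /w; move: K0 z0; move: (m.+2%:R) m.+1%:R => K z K0 z0; field; rewrite !gt_eqF.
    by rewrite exprMn (exprS m.+2%:R) /vertex_coef; ring.
  apply: le_trans (_ : m.+2%:R * (103%:R / 100%:R * w) ^+ 4 <= _).
    by rewrite ler_wpM2l ?ler0n // ler_wiXn2l //; lra.
  have -> : m.+2%:R * (103%:R / 100%:R * w) ^+ 4 =
      (103%:R / 100%:R) ^+ 4 * ((1 + w) * w ^+ 3).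
    rewrite -(natr1 m.+1) /w !exprS !expr0; move: z0; move: m.+1%:R => z z0.
    by field; rewrite gt_eqF.
  apply: le_trans (_ : (103%:R / 100%:R) ^+ 4 * ((5%:R / 4%:R) * 4%:R^-1 ^+ 3) <= _);
    last by rewrite !exprS !expr0; lra.
  apply: ler_wpM2l; first by rewrite exprn_ge0 // divr_ge0.
  apply: ler_pM; rewrite ?exprn_ge0 //; try lra.
  by rewrite lerXn2r ?nnegrE //; lra.
have B3 : (53%:R / 100%:R) ^+ m.+1 <= 79%:R / 1000%:R :> R.
  apply: le_trans (_ : (53%:R / 100%:R) ^+ 4 <= _); last by rewrite !exprS expr0; lra.
  by rewrite ler_wiXn2l //; lra.
apply: le_trans (lerD (ler_wpM2r c0 Mle) B3) _.
rewrite mulrDr; lra.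
Qed.

(** A convex quadratic lies below its chord; [h3] is the gap up to a positive factor. *)
Lemma affine_square_max (A B l u p : R) : l <= p -> p <= u ->
  2 * l ^+ 2 + A * l + B <= 0 -> 2 * u ^+ 2 + A * u + B <= 0 ->
  2 * p ^+ 2 + A * p + B <= 0.
Proof.
rewrite le_eqVlt => /orP[/eqP <- //|lp] pu hl hu.
rewrite -(pmulr_rle0 _ (_ : 0 < u - l)); last by lra.
have h1 : (u - p) * (2 * l ^+ 2 + A * l + B) <= 0 by rewrite mulr_ge0_le0 //; lra.
have h2 : (p - l) * (2 * u ^+ 2 + A * u + B) <= 0 by rewrite mulr_ge0_le0 //; lra.
have h3 : 0 <= (u - l) * ((u - p) * (p - l)) by rewrite !mulr_ge0 //; lra.
move: h1 h2 h3; rewrite !expr2 => h1 h2 h3; lra.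
Qed.

End NumericalBounds.

(** * Part sizes for [k = 4] *)

Section FourParts.
Local Open Scope ring_scope.
Variable R : realFieldType.

Lemma quartic_le_cap (x k : R) : 0 <= x <= k -> x ^+ 4 <= k ^+ 3 * x.
Proof.
move=> /andP[x0 xk]; rewrite exprSr ler_wpM2r // lerXn2r ?nnegrE //; lra.
Qed.

(* For [k = 4]: 252 = 4^4 - 4, 4/25 bounds 252 * vertex_coef, and 16/5 is at most
   252 * vertex_coef / edge_coef.  The bound is convex in [a * b] and in [c * d] for fixed sums [a + b] and
   [c + d], so only extreme values of these products matter. *)
Lemma four_parts (a b c d : R) : a + b + c + d = 1 ->
  0 <= a <= 16%:R / 25%:R -> 0 <= b <= 16%:R / 25%:R ->
  0 <= c <= 16%:R / 25%:R -> 0 <= d <= 16%:R / 25%:R ->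
  c * d <= 1 / 20%:R ->
  252%:R * (a * b * (c * d)) - 16%:R / 5%:R * (c * d) + 4%:R / 25%:R
    + (a ^+ 4 + b ^+ 4 + c ^+ 4 + d ^+ 4) <= 1.
Proof.
move=> sum1 ha hb hc hd hcd.
have := (quartic_le_cap ha, quartic_le_cap hb, quartic_le_cap hc, quartic_le_cap hd).
move=> [[[qa qb] qc] qd].
have S1 : a ^+ 4 + b ^+ 4 + c ^+ 4 + d ^+ 4 <= 27%:R / 100%:R.
  apply: le_trans (lerD (lerD (lerD qa qb) qc) qd) _.
  by rewrite -!mulrDr sum1 !exprS expr0; lra.
clear qa qb qc qd.
move: ha hb hc hd => /andP[a0 a1] /andP[b0 b1] /andP[c0 c1] /andP[d0 d1].
pose s := a + b; pose p := a * b; pose t := c * d.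
have p0 : 0 <= p by rewrite mulr_ge0.
have t0 : 0 <= t by rewrite mulr_ge0.
have pu : p <= s ^+ 2 / 4%:R by have := sqr_ge0 (a - b); rewrite /p /s !expr2; lra.
have tu : t <= (1 - s) ^+ 2 / 4%:R.
  have -> : 1 - s = c + d by rewrite /s; lra.
  by have := sqr_ge0 (c - d); rewrite /t !expr2; lra.
have S2 : a ^+ 4 + b ^+ 4 + c ^+ 4 + d ^+ 4 =
  (s ^+ 4 - 4%:R * s ^+ 2 * p + 2 * p ^+ 2) +
  ((1 - s) ^+ 4 - 4%:R * (1 - s) ^+ 2 * t + 2 * t ^+ 2).
  have -> : 1 - s = c + d by rewrite /s; lra.
  by rewrite /s /p /t; ring.
have s0 : 0 <= s by rewrite /s; lra.
have s1 : s <= 1 by rewrite /s; lra.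
rewrite -/t in hcd.
have sq0 := sqr_ge0 s; have rq0 := sqr_ge0 (1 - s).
have t2 : 2 * t ^+ 2 <= 4%:R * (1 - s) ^+ 2 * t.
  by rewrite expr2 mulrA ler_wpM2r //; lra.
(* For small [s] the product [p] is so small that the crude bound [S1] on the fourth powers
   suffices. *)
have [sk|sk] := ltP s (9%:R / 25%:R).
  have p1 : p <= 1 / 30%:R.
    have : s * s <= (9%:R / 25%:R) * (9%:R / 25%:R) by apply: ler_pM; lra.
    by move: pu; rewrite expr2; lra.
  have : t * (252%:R * p - 16%:R / 5%:R) <= 1 / 20%:R * (26%:R / 5%:R).
    apply: le_trans (_ : t * (26%:R / 5%:R) <= _); first by apply: ler_wpM2l; lra.
    by apply: ler_wpM2r; lra.
  rewrite -/p -/t; lra.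
clear S1.
have r4 : (1 - s) ^+ 4 <= (16%:R / 25%:R) ^+ 3 * (1 - s) by apply: quartic_le_cap; lra.
have {}r4 : (1 - s) ^+ 4 <= 17%:R / 100%:R.
  apply: le_trans r4 (le_trans (ler_wpM2l _ (_ : _ <= 16%:R / 25%:R)) _);
    rewrite ?exprn_ge0 ?divr_ge0 //; first lra.
  by rewrite !exprS expr0; lra.
have s4 : s ^+ 4 <= 1 by rewrite exprn_ile1.
(* The bound at the largest value [p = s ^+ 2 / 4], that is, for [a = b]. It is convex in [t], so
   only [t = 0] and [t = (1 - s) ^+ 2 / 4] are checked. *)
have upper : 63%:R * s ^+ 2 * t - 16%:R / 5%:R * t + 4%:R / 25%:R
    + (s ^+ 4 / 8%:R + ((1 - s) ^+ 4 - 4%:R * (1 - s) ^+ 2 * t + 2 * t ^+ 2)) <= 1.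
  rewrite -subr_le0.
  pose A := 63%:R * s ^+ 2 - 16%:R / 5%:R - 4%:R * (1 - s) ^+ 2.
  pose B := 4%:R / 25%:R + s ^+ 4 / 8%:R + (1 - s) ^+ 4 - 1.
  suff : 2 * t ^+ 2 + A * t + B <= 0 by rewrite /A /B; lra.
  apply: affine_square_max t0 tu _ _; first by rewrite /B expr2; lra.
  pose w := s - 1 / 2; have sw : s = 1 / 2 + w by rewrite /w; lra.
  have w1 : w <= 1 / 2 by lra.
  have w0 : - (1 / 2) <= w by lra.
  have ww : w * w <= 1 / 4 by nra.
  have w4 : (w * w) * (w * w) <= 1 / 4 * (w * w) by rewrite ler_wpM2r // -expr2 sqr_ge0.
  (* After [w4] the expression is at most [- 43/10 * w ^ 2 + 4/5 * w - 1/25], whose maximum, at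
     [w = 4/43], is negative. *)
  have w2 := sqr_ge0 (w - 4%:R / 43%:R); rewrite expr2 in w2.
  rewrite /A /B sw !exprS !expr0; lra.
(* By convexity in [p] and [upper], it remains to check some lower bound [l] of [p]. *)
have lower (l : R) : l <= p -> 0 <= l ->
  252%:R * (l * t) - 16%:R / 5%:R * t + 4%:R / 25%:R
    + ((s ^+ 4 - 4%:R * s ^+ 2 * l + 2 * l ^+ 2) +
       ((1 - s) ^+ 4 - 4%:R * (1 - s) ^+ 2 * t + 2 * t ^+ 2)) <= 1 ->
  252%:R * (p * t) - 16%:R / 5%:R * t + 4%:R / 25%:R
    + ((s ^+ 4 - 4%:R * s ^+ 2 * p + 2 * p ^+ 2) +
       ((1 - s) ^+ 4 - 4%:R * (1 - s) ^+ 2 * t + 2 * t ^+ 2)) <= 1.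
  move=> lp l0 hl.
  pose A := 252%:R * t - 4%:R * s ^+ 2.
  pose B := 4%:R / 25%:R - 16%:R / 5%:R * t + s ^+ 4 +
     ((1 - s) ^+ 4 - 4%:R * (1 - s) ^+ 2 * t + 2 * t ^+ 2) - 1.
  suff : 2 * p ^+ 2 + A * p + B <= 0 by rewrite /A /B; lra.
  apply: affine_square_max lp pu _ _; rewrite /A /B; first lra.
  move: upper; rewrite (_ : s ^+ 4 = s ^+ 2 * s ^+ 2) -?exprD // => up.
  rewrite (expr2 (s ^+ 2 / 4%:R)); lra.
rewrite S2 -/p -/t; have [sk'|sk'] := leP s (16%:R / 25%:R).
  apply: (lower 0) => //.
  have : s ^+ 4 <= (16%:R / 25%:R) ^+ 3 * s by apply: quartic_le_cap; lra.
  move=> {}s4.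
  have {}s4 : s ^+ 4 <= 17%:R / 100%:R.
    apply: le_trans s4 (le_trans (ler_wpM2l _ (_ : _ <= 16%:R / 25%:R)) _);
      rewrite ?exprn_ge0 ?divr_ge0 //; lra.
  lra.
(* The caps on [a] and [b] force [p] to be at least its value when one of them equals [16/25]. *)
have kp : 16%:R / 25%:R * (s - 16%:R / 25%:R) <= p.
  have : 0 <= (16%:R / 25%:R - a) * (16%:R / 25%:R - b) by rewrite mulr_ge0 //; lra.
  by rewrite /p /s; lra.
pose v := s - 16%:R / 25%:R; have v0 : 0 <= v by rewrite /v; lra.
have sv : s = 16%:R / 25%:R + v by rewrite /v; lra.
have v1 : v <= 9%:R / 25%:R by lra.
have vr : v * (1 - s) ^+ 2 <= 1 / 140%:R.
  (* Here [1 - s = 9/25 - v], and [v * (9/25 - v) ^ 2] is largest at [v = 12/100]; this product is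
     the distance to that maximum. *)
  have : 0 <= (v - 12%:R / 100%:R) ^+ 2 * (48%:R / 100%:R - v).
    by rewrite mulr_ge0 ?sqr_ge0 //; lra.
  by rewrite sv !expr2; lra.
have vt : v * t <= 1 / 560%:R.
  apply: le_trans (ler_wpM2l v0 tu) _; lra.
apply: lower kp _ _; first by apply: mulr_ge0 => //; lra.
have -> : s ^+ 4 - 4%:R * s ^+ 2 * (16%:R / 25%:R * (s - 16%:R / 25%:R)) +
  2 * (16%:R / 25%:R * (s - 16%:R / 25%:R)) ^+ 2 = (16%:R / 25%:R) ^+ 4 + v ^+ 4.
  by rewrite /v; ring.
have v4 : v ^+ 4 <= (9%:R / 25%:R) ^+ 4 by rewrite lerXn2r ?nnegrE //; lra.
rewrite -/v; have : (9%:R / 25%:R) ^+ 4 <= 2%:R / 100%:R :> R by rewrite !exprS expr0; lra.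
have : (16%:R / 25%:R) ^+ 4 <= 17%:R / 100%:R :> R by rewrite !exprS expr0; lra.
lra.
Qed.
End FourParts.

(** * Optimising the part sizes *)

Section PartSizes.
Local Open Scope ring_scope.
Variable R : realFieldType.

Lemma edge_coef_gt0 m : (2 <= m)%N -> 0 < edge_coef R m.
Proof.
move=> m2; have y0 : (0 : R) < m%:R by rewrite ltr0n; lia.
apply: mulr_gt0; last by rewrite exprn_gt0 // divr_gt0 // eps_gt0.
by rewrite !divr_gt0 // mulr_gt0 // ltr0n.
Qed.

Lemma edge_coef2 : edge_coef R 2 = 3%:R * (103%:R / 800%:R) ^+ 2.
Proof. by rewrite /edge_coef /eps; field. Qed.

Lemma vertex_coef2 : vertex_coef R 2 = (103%:R / 1200%:R) ^+ 3.
Proof. by rewrite /vertex_coef /eps; field. Qed.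

Lemma card_complement2 (i j : 'I_4) : i != j ->
  exists c d : 'I_4, c != d /\ [set~ i] :\ j = [set c; d].
Proof.
move=> ij; apply/cards2P.
have := cardsD1 j [set~ i]; rewrite cardsC1 card_ord !inE eq_sym ij.
by lia.
Qed.

(** Write [K] and [V] for the edge and vertex coefficients and [t] for the product of the two other
    sizes. Since [mu <= e * K], [mu <= V] and [t < K], one has [mu - e * t <= mu * (1 - t / K) <= V
    * (1 - t / K)], which eliminates [e] and [mu] and leaves [four_parts]. *)
Lemma part_sizes4 (x : 'I_4 -> R) (i j : 'I_4) (e mu : R) :
  (forall l, 0 <= x l) -> \sum_l x l = 1 -> (forall l, x l <= 16%:R / 25%:R) ->
  i != j -> mu <= e * edge_coef R 2 -> mu <= vertex_coef R 2 ->
  \prod_(l | (l != i) && (l != j)) x l < edge_coef R 2 ->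
  252%:R * (\prod_l x l - e * \prod_(l | (l != i) && (l != j)) x l + mu)
    + \sum_l x l ^+ 4 <= 1.
Proof.
move=> x0 sum1 cap ij mue muv.
have [c [d [cd E]]] := card_complement2 ij.
have inA l : (l != i) && (l != j) = (l \in [set c; d]).
  by rewrite -E !inE andbC.
have prodE (F : 'I_4 -> R) : \prod_(l | (l != i) && (l != j)) F l = F c * F d.
  by rewrite (eq_bigl _ _ inA) big_setU1 ?inE //= big_set1.
have sumE (F : 'I_4 -> R) : \sum_l F l = F i + F j + F c + F d.
  rewrite (bigD1 i) //= (bigD1 j) /=; last by rewrite eq_sym.
  by rewrite (eq_bigl _ _ inA) big_setU1 ?inE //= big_set1 !addrA.
have -> : \prod_l x l = x i * x j * (x c * x d).
  rewrite (bigD1 i) //= (bigD1 j) /=; last by rewrite eq_sym.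
  by rewrite prodE mulrA.
rewrite prodE sumE; move: sum1; rewrite sumE => sum1.
have ge0 l : 0 <= x l <= 16%:R / 25%:R by rewrite x0 cap.
have K0 := @edge_coef_gt0 2 isT.
move=> small.
have := @four_parts R (x i) (x j) (x c) (x d) sum1 (ge0 i) (ge0 j) (ge0 c) (ge0 d).
have t0 : 0 <= x c * x d by rewrite mulr_ge0.
move: (x c * x d) t0 small => t t0 small.
have tK : t <= 1 / 20%:R by apply: le_trans (ltW small) _; rewrite edge_coef2 expr2; lra.
move=> /(_ tK) main.
have c1 : 252%:R * vertex_coef R 2 <= 4%:R / 25%:R.
  rewrite vertex_coef2 !exprS !expr0; lra.
have c2 : 16%:R / 5%:R * edge_coef R 2 <= 252%:R * vertex_coef R 2.
  rewrite vertex_coef2 edge_coef2 !exprS !expr0; lra.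
have h : 252%:R * (mu - e * t) <= 4%:R / 25%:R - 16%:R / 5%:R * t.
  rewrite -(ler_pM2r K0).
  have : 0 <= t * (e * edge_coef R 2 - mu) by rewrite mulr_ge0 // subr_ge0.
  have : 0 <= (vertex_coef R 2 - mu) * (edge_coef R 2 - t).
    by rewrite mulr_ge0 ?subr_ge0 // ltW.
  have : 0 <= (4%:R / 25%:R - 252%:R * vertex_coef R 2) * edge_coef R 2.
    by rewrite mulr_ge0 ?subr_ge0 // ltW.
  have : 0 <= t * (252%:R * vertex_coef R 2 - 16%:R / 5%:R * edge_coef R 2).
    by rewrite mulr_ge0 ?subr_ge0.
  move: (edge_coef R 2) (vertex_coef R 2) => K V *; lra.
lra.
Qed.

(** If the product [Q] of the sizes other than [x i] and [x j] is at least [edge_coef], the lost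
    transversals [e * Q] outweigh [mu], and [sum_expn_AGM] concludes. Otherwise
    [\prod_l x l <= Q / 4] is itself small, and for [k >= 5] the crude estimates of [coef_bound]
    suffice. *)
Theorem part_sizes_bound m (x : 'I_m.+2 -> R) (i j : 'I_m.+2) (e mu : R) :
  (2 <= m)%N -> (forall l, 0 <= x l) -> \sum_l x l = 1 ->
  (forall l, x l <= 2 * eps R m + (1 - 2 * eps R m) / m.+2%:R) ->
  i != j -> 0 <= e -> mu <= e * edge_coef R m -> mu <= vertex_coef R m ->
  (m.+2 ^ m.+2 - m.+2)%:R *
    (\prod_l x l - e * \prod_(l | (l != i) && (l != j)) x l + mu)
    + \sum_l x l ^+ m.+2 <= 1.
Proof.
move=> m2 x0 sum1 cap ij e0 mue muv.
set Q := \prod_(l | _ && _) x l; set P := \prod_l x l.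
have Q0 : 0 <= Q by rewrite prodr_ge0.
have PE : P = x i * x j * Q.
  by rewrite /P (bigD1 i) //= (bigD1 j) /= ?mulrA // eq_sym.
have [big|small] := leP (edge_coef R m) Q.
  have := @sum_expn_AGM R m.+2 x isT x0; rewrite sum1 expr1n; apply: le_trans.
  rewrite lerD2r ler_wpM2l ?ler0n // -/P.
  by have := ler_wpM2l e0 big; lra.
move: m2; rewrite leq_eqVlt => /orP[/eqP m2|m3].
  subst m; apply: part_sizes4 => // l; apply: le_trans (cap l) _; rewrite /eps; lra.
have xij : x i * x j <= 1 / 4.
  have : x i + x j <= 1.
    rewrite -sum1 (bigD1 i) //= (bigD1 j) /=; last by rewrite eq_sym.
    by rewrite lerD2l lerDl sumr_ge0.
  have := x0 i; have := x0 j; have := sqr_ge0 (x i - x j); rewrite expr2.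
  by move: (x i) (x j) => a b; nra.
have e1 := eps_gt0 R m.
have eE : eps R m * m.+2%:R = 103%:R / 100%:R by rewrite /eps divfK // pnatr_eq0.
have K5 : (5%:R : R) <= m.+2%:R by rewrite ler_nat.
have capm l : x l <= 53%:R / 100%:R.
  apply: le_trans (cap l) _.
  pose u : R := m.+2%:R^-1.
  have u0 : 0 < u by rewrite invr_gt0 ltr0n.
  have u5 : u <= 5%:R^-1 by rewrite lef_pV2 ?posrE ?ltr0n.
  rewrite -/u; have -> : eps R m = 103%:R / 100%:R * u by [].
  have : 0 <= (5%:R^-1 - u) * (5%:R^-1 - u) by rewrite mulr_ge0 ?subr_ge0.
  nra.
have sumle : \sum_l x l ^+ m.+2 <= (53%:R / 100%:R) ^+ m.+1.
  by have := @sum_expn_le_max R _ predT x m.+1 _ x0 (fun l _ => capm l); rewrite sum1 mulr1.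
apply: le_trans (coef_bound R m3); apply: lerD => //.
rewrite ler_wpM2l ?ler0n // lerD //.
have : x i * x j * Q <= 1 / 4 * edge_coef R m.
  by apply: ler_pM => //; [rewrite mulr_ge0|exact: ltW].
have : 0 <= e * Q by rewrite mulr_ge0.
by rewrite PE; lra.
Qed.

End PartSizes.

(** * The upper bound *)

Lemma card_family_prod (I T : finType) (F : I -> {set T}) :
  #|[set f : {ffun I -> T} | [forall i, f i \in F i]]| = \prod_i #|F i|.
Proof.
have -> : #|[set f : {ffun I -> T} | [forall i, f i \in F i]]| = #|family F|.
  by rewrite cardsE; apply: eq_card => f; apply/forallP/familyP.
by rewrite card_family foldrE big_map big_enum.
Qed.

Lemma card_bigcup_le (I T : finType) (P : pred I) (F : I -> {set T}) :
  #|\bigcup_(i | P i) F i| <= \sum_(i | P i) #|F i|.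
Proof.
elim/big_rec2: _ => [|i n A _ IH]; first by rewrite cards0.
by apply: leq_trans (leq_card_setU _ _) _; rewrite leq_add2l.
Qed.

Lemma sum_bool_le1 (I : finType) (P : pred I) :
  (forall a b, P a -> P b -> a = b) -> \sum_a (P a : nat) <= 1.
Proof.
move=> uP; rewrite -big_mkcond sum1_card; apply/card_le1_eqP => a b.
by rewrite !unfold_in => Pa Pb; exact: uP.
Qed.

(* Counts the pairs [(a, b)] of a non-fixed point and a point outside its
   [g]-class; a class of size [c] contains at most one fixed point and
   [(c - 1) * (k - c) >= k - 2] for [1 < c < k]. *)
Lemma card_non_fixed_cross_pairs m (g : 'I_m.+2 -> 'I_m.+2) :
  (exists a, g a != a) -> (forall c, exists b, g b != c) ->
  2 * m <= #|[set p : 'I_m.+2 * 'I_m.+2 |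
     (g p.1 != g p.2) && ~~ ((g p.1 == p.1) && (g p.2 == p.2))]|.
Proof.
move=> [a ga] nconst.
pose P := [set b | g b == g a].
pose A := [set b in P | g b != b].
have aP : a \in P by rewrite inE.
have aA : a \in A by rewrite !inE eqxx.
have cA : #|P| <= #|A|.+1.
  rewrite -(cardsID [set b | g b == b] P) -[#|A|.+1]add1n leq_add //.
    apply/card_le1_eqP => b c; rewrite !inE => /andP[/eqP b1 /eqP b2] /andP[/eqP c1 /eqP c2].
    by rewrite -b2 -c2 b1 c1.
  by apply: subset_leq_card; apply/subsetP => b; rewrite !inE andbC.
have A0 : 0 < #|A| by apply/card_gt0P; exists a.
have cP : #|P| + #|~: P| = m.+2 by rewrite cardsC card_ord.
have CP : 0 < #|~: P|.
  by have [b gb] := nconst (g a); apply/card_gt0P; exists b; rewrite !inE.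
have P0 : 0 < #|P| by apply/card_gt0P; exists a.
set Z := [set p | _].
have sub : setX A (~: P) :|: setX (~: P) A \subset Z.
  apply/subsetP => -[b c]; rewrite !inE /=.
  case/orP => [/andP[/andP[/eqP b1 b2] c1]|/andP[c1 /andP[/eqP b1 b2]]].
    by rewrite b1 eq_sym c1 -b1 (negPf b2).
  by rewrite b1 c1 -b1 (negPf b2) andbF.
have dis : [disjoint setX A (~: P) & setX (~: P) A].
  apply/pred0P => -[b c]; rewrite !inE /=; apply/negP.
  by case/andP => /andP[/andP[b1 _] _] /andP[]; rewrite b1.
apply: leq_trans (subset_leq_card sub).
rewrite cardsU (disjoint_setI0 dis) cards0 subn0 !cardsX.
by nia.
Qed.

Lemma card_predC2 m (i j : 'I_m.+2) : i != j -> #|[pred l | (l != i) && (l != j)]| = m.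
Proof.
move=> ij; have := cardsD1 j [set~ i]; rewrite cardsC1 card_ord !inE eq_sym ij add1n => -[E].
by apply: etrans (esym E); apply: eq_card => l; rewrite !inE andbC.
Qed.

Lemma expn_succ_ge a n : a ^ n.+1 + n.+1 * a ^ n <= a.+1 ^ n.+1.
Proof.
elim: n => [|n IH]; first by rewrite expn0 !expn1; lia.
rewrite (expnS a.+1); apply: leq_trans (leq_mul (leqnn a.+1) IH).
by rewrite !expnS; move: (a ^ n) => X; nia.
Qed.

(** * Copies counted through the roles of their vertices *)

Section Roles.
Variables (T : finType) (m : nat).
Let k := m.+2.
Implicit Types (f : {ffun 'I_k -> T}) (W : {set T}) (x y : T) (i j : 'I_k).
(* [L x y i j]: in any copy of the coloured tournament containing the vertices
   [x] and [y], they play the roles [i] and [j]. *)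
Variable L : T -> T -> 'I_k -> 'I_k -> bool.
Hypothesis L_vertex : forall x y i j, L x y i j -> x != y.
Hypothesis L_role : forall x y i j, L x y i j -> i != j.
Hypothesis L_sym : forall x y i j, L x y i j = L y x j i.
Hypothesis L_uniq : forall x y i j i' j', L x y i j -> L x y i' j' -> i = i' /\ j = j'.

(** Copies are maps from roles to vertices rather than vertex sets; [ncopiesE] identifies the two
    counts. *)
Definition role_copy (f : {ffun 'I_k -> T}) : bool :=
  [forall i, forall j, (i != j) ==> L (f i) (f j) i j].

Definition role_copies (W : {set T}) : {set {ffun 'I_k -> T}} :=
  [set f | role_copy f & [forall i, f i \in W]].

Definition role_nbrs (W : {set T}) (x : T) (i j : 'I_k) : {set T} :=
  [set y in W | L x y i j].

Definition role_degree (W : {set T}) (x : T) (i : 'I_k) : nat :=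
  \sum_j #|role_nbrs W x i j|.

Lemma role_copyP f : reflect (forall i j, i != j -> L (f i) (f j) i j) (role_copy f).
Proof.
apply: (iffP forallP) => h i; first by move=> j ij; have /forallP/(_ j)/implyP := h i; apply.
by apply/forallP => j; apply/implyP; exact: h.
Qed.

Lemma role_copiesP W f : reflect (role_copy f /\ forall i, f i \in W) (f \in role_copies W).
Proof.
rewrite inE; apply: (iffP andP) => -[h1 h2]; split => //; first exact/forallP.
exact/forallP.
Qed.

Lemma role_copy_inj f : role_copy f -> injective f.
Proof.
move=> /role_copyP cf i j fij; apply/eqP; case: (boolP (i == j)) => // ij.
by have := L_vertex (cf _ _ ij); rewrite fij eqxx.
Qed.

Lemma role_copies_card W f : f \in role_copies W -> k <= #|W|.
Proof.
move=> /role_copiesP[/role_copy_inj f_inj fW].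
rewrite -[k]card_ord -(card_imset _ f_inj) subset_leq_card //.
by apply/subsetP => _ /imsetP[i _ ->].
Qed.

Lemma card_role_nbrs W x i j : #|role_nbrs W x i j| = \sum_(y in W) (L x y i j : nat).
Proof.
rewrite -sum1_card big_mkcond [RHS]big_mkcond; apply: eq_bigr => y _.
by rewrite inE; case: (y \in W); case: (L _ _ _ _).
Qed.

Lemma sum_L_role_le1 x y i : \sum_j (L x y i j : nat) <= (x != y).
Proof.
case: (eqVneq x y) => [<-|xy].
  by rewrite big1 // => j _; case: (boolP (L x x i j)) => // /L_vertex; rewrite eqxx.
by apply: sum_bool_le1 => j j' h h'; have [] := L_uniq h h'.
Qed.

Lemma sum_role_degree W x : x \in W -> \sum_i role_degree W x i <= #|W|.-1.
Proof.
move=> xW.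
have -> : #|W|.-1 = \sum_(y in W) ((x != y) : nat).
  rewrite (bigD1 x) //= eqxx add0n (cardsD1 x W) xW /= -sum1_card.
  rewrite (eq_bigl (fun y => (y \in W) && (y != x))); last by move=> y; rewrite !inE andbC.
  by apply: eq_bigr => y /andP[_]; rewrite eq_sym => ->.
rewrite /role_degree.
under eq_bigr => i _ do under eq_bigr => j _ do rewrite card_role_nbrs.
rewrite pair_big /= exchange_big /=; apply: leq_sum => y _.
case: (eqVneq x y) => [<-|xy].
  by rewrite big1 // => p _; case: (boolP (L _ _ _ _)) => // /L_vertex; rewrite eqxx.
apply: sum_bool_le1 => -[i j] [i' j'] /= h h'.
by have [-> ->] := L_uniq h h'.
Qed.

Lemma card_copies_vertex W x i :
  #|[set f in role_copies W | f i == x]| <= \prod_(j | j != i) #|role_nbrs W x i j|.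
Proof.
pose F j := if j == i then [set x] else role_nbrs W x i j.
apply: (@leq_trans #|[set f : {ffun 'I_k -> T} | [forall j, f j \in F j]]|).
  apply: subset_leq_card; apply/subsetP => f; rewrite inE => /andP[/role_copiesP[/role_copyP cf fW] /eqP fi].
  rewrite inE; apply/forallP => j; rewrite /F; case: eqVneq => [->|ji]; first by rewrite inE fi.
  by rewrite inE fW -fi cf // eq_sym.
rewrite card_family_prod (bigD1 i) //= {1}/F eqxx cards1 mul1n.
by apply: leq_prod => j /negPf ji; rewrite /F ji.
Qed.

Lemma card_pinned_family (F : 'I_k -> {set T}) i j x y : i != j ->
  #|[set f : {ffun 'I_k -> T} | [forall l, f l \in
      (if l == i then [set x] else if l == j then [set y] else F l)]]| =
  \prod_(l | (l != i) && (l != j)) #|F l|.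
Proof.
move=> ij; rewrite card_family_prod (bigD1 i) //= eqxx cards1 mul1n.
rewrite (bigD1 j) /=; last by rewrite eq_sym.
rewrite [j == i]eq_sym (negPf ij) eqxx cards1 mul1n.
by apply: eq_bigr => l /andP[/negPf -> /negPf ->].
Qed.

Lemma card_copies_edge W x y i j : i != j ->
  #|[set f in role_copies W | (f i == x) && (f j == y)]| <=
    \prod_(l | (l != i) && (l != j)) #|role_nbrs W x i l|.
Proof.
move=> ij; rewrite -(@card_pinned_family (role_nbrs W x i) i j x y ij).
apply: subset_leq_card; apply/subsetP => f; rewrite !inE.
move=> /andP[/andP[/role_copyP cf /forallP fW] /andP[/eqP fi /eqP fj]].
apply/forallP => l; case: eqVneq => [->|li]; first by rewrite inE fi.
case: eqVneq => [->|lj]; first by rewrite inE fj.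
by rewrite inE fW -fi cf // eq_sym.
Qed.

Local Open Scope ring_scope.
Variable R : realFieldType.

(** AM-GM: the neighbour counts over the roles in [A] sum to at most the role degree. *)
Lemma prod_role_nbrs_le (A : {pred 'I_k}) W x i :
  \prod_(j in A) (#|role_nbrs W x i j|%:R : R) <=
    ((role_degree W x i)%:R / #|A|%:R) ^+ #|A|.
Proof.
have [+ _] := @leif_AGM R _ A (fun j => #|role_nbrs W x i j|%:R) (fun j _ => ler0n _ _).
move=> /le_trans; apply; rewrite lerXn2r ?nnegrE ?divr_ge0 ?sumr_ge0 ?ler0n //.
rewrite ler_wpM2r ?invr_ge0 ?ler0n // -natr_sum ler_nat /role_degree.
by rewrite [leqRHS](bigID (mem A)) /= leq_addr.
Qed.

Lemma copies_vertex_le W x i :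
  (#|[set f in role_copies W | f i == x]|%:R : R) <=
    ((role_degree W x i)%:R / m.+1%:R) ^+ m.+1.
Proof.
have := @prod_role_nbrs_le (predC1 i) W x i; rewrite cardC1 card_ord /=.
by apply: le_trans; rewrite -natr_prod ler_nat card_copies_vertex.
Qed.

Lemma copies_edge_le W x y i j : i != j ->
  (#|[set f in role_copies W | (f i == x) && (f j == y)]|%:R : R) <=
    ((role_degree W x i)%:R / m%:R) ^+ m.
Proof.
move=> ij; have := @prod_role_nbrs_le [pred l | (l != i) && (l != j)] W x i.
rewrite card_predC2 //.
by apply: le_trans; rewrite -natr_prod ler_nat card_copies_edge.
Qed.

(** * Vertex sets with dominant roles *)

Section DominantRoles.
Variables (W : {set T}) (r : T -> 'I_k).
Hypothesis m_ge2 : (2 <= m)%N.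
Hypothesis W_ge : (k <= #|W|)%N.
Hypothesis dominant : forall x, x \in W ->
  (1 - eps R m) * #|W|.-1%:R < (role_degree W x (r x))%:R.

Definition part (c : 'I_k) : {set T} := [set x in W | r x == c].

Definition bad_pairs (i j : 'I_k) : {set T * T} :=
  [set p | [&& p.1 \in part i, p.2 \in part j & ~~ L p.1 p.2 i j]].

Definition transversal_copies : {set {ffun 'I_k -> T}} :=
  [set f in role_copies W | [forall i, r (f i) == i]].

(** The last clause says that [r] is not constant on the copy, so it excludes the copies inside one
    part. *)
Definition mixed_copies : {set {ffun 'I_k -> T}} :=
  [set f in role_copies W | ~~ [forall i, r (f i) == i] &
                            [forall c, exists b, r (f b) != c]].

(** A label gives the two ends of a pair distinct roles, so at most one end plays [c]. *)
Lemma sum_L_role_antisym x y c :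
  (\sum_j (L x y c j : nat) + \sum_j (L y x c j : nat) <= (x != y))%N.
Proof.
case: (boolP [exists j, L x y c j]) => [/existsP[j h]|/existsPn h].
  rewrite [X in (_ + X)%N]big1 ?addn0 ?sum_L_role_le1 // => j' _.
  case: (boolP (L y x c j')) => // h'; rewrite L_sym in h'.
  by have [_ jc] := L_uniq h h'; have := L_role h; rewrite jc eqxx.
rewrite [X in (X + _)%N]big1 ?add0n; last by move=> j _; rewrite (negPf (h j)).
by rewrite eq_sym sum_L_role_le1.
Qed.

(** A pair inside [V] contributes at most once, by [sum_L_role_antisym], and so does a pair leaving
    [V]. Doubling avoids the fraction in [v * (v - 1) / 2]. *)
Lemma sum_role_degree_part (V : {set T}) c : V \subset W ->
  (2 * (\sum_(x in V) role_degree W x c) + #|V|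
     <= #|V| * #|V| + 2 * (#|V| * (#|W| - #|V|)))%N.
Proof.
move=> VW.
have degE x : role_degree W x c =
    (\sum_(y in V) \sum_j (L x y c j : nat) + \sum_(y in W :\: V) \sum_j (L x y c j : nat))%N.
  rewrite /role_degree; under eq_bigr => j _ do rewrite card_role_nbrs.
  by rewrite exchange_big /= (big_setID V) /= (setIidPr VW).
under eq_bigr => x _ do rewrite degE.
rewrite big_split /=; set d := (\sum_(x in V) \sum_(y in V) _)%N.
set d' := (\sum_(x in V) _)%N.
have hd : (d + d + #|V| <= #|V| * #|V|)%N.
  rewrite -[X in (_ + X <= _)%N]sum1_card {2}/d exchange_big /= -!big_split /= -sum_nat_const.
  apply: leq_sum => x xV; rewrite -big_split /=.
  have -> : 1%N = (\sum_(y in V) (x == y : nat))%N.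
    rewrite (bigD1 x) //= eqxx big1 // => y /andP[_]; rewrite eq_sym.
    by move/negPf ->.
  rewrite -big_split /= -sum1_card; apply: leq_sum => y _.
  by have := sum_L_role_antisym x y c; case: eqVneq => _ /=; lia.
have hd' : (d' <= #|V| * (#|W| - #|V|))%N.
  rewrite -sum_nat_const -(cardsDS VW); apply: leq_sum => x _.
  rewrite -sum1_card; apply: leq_sum => y _.
  by apply: leq_trans (sum_L_role_le1 _ _ _) _; case: eqP.
lia.
Qed.

Lemma part_sub c : part c \subset W.
Proof. by apply/subsetP => x; rewrite inE => /andP[]. Qed.

(** All [v] vertices of the part have degree above [(1 - eps) * (n - 1)] in the same role [c], while
    by [sum_role_degree_part] their average is at most [(v - 1) / 2 + n - v]. *)
Lemma part_cap c : #|part c|%:R <= 2 * eps R m * #|W|.-1%:R + 1.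
Proof.
have e0 := eps_gt0 R m.
have ew : 0 <= eps R m * #|W|.-1%:R by rewrite mulr_ge0 ?ler0n // ltW.
have [->|V0] := posnP #|part c|; first by rewrite mulr0n; lra.
have h1 : #|part c|%:R * ((1 - eps R m) * #|W|.-1%:R) <=
    (\sum_(x in part c) role_degree W x c)%:R.
  rewrite natr_sum mulr_natl -sumr_const; apply: ler_sum => x.
  by rewrite inE => /andP[xW /eqP <-]; exact/ltW/dominant.
have := sum_role_degree_part c (part_sub c).
rewrite -(ler_nat R) !natrD !natrM natrB ?subset_leq_card ?part_sub //.
move: h1; have -> : #|W|%:R = #|W|.-1%:R + 1 :> R by rewrite natr1 prednK // (leq_trans _ W_ge).
move: V0; rewrite -(ltr0n R); move: (_%:R) (_%:R) (_%:R) (eps R m) => v q w e v0 h1 h2.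
by rewrite -(ler_pM2l v0); lra.
Qed.

Lemma nondominant_degree x : x \in W ->
  \sum_(i | i != r x) ((role_degree W x i)%:R : R) <= eps R m * #|W|%:R.
Proof.
move=> xW; have := sum_role_degree xW; rewrite -(ler_nat R) natr_sum (bigD1 (r x)) //=.
have := dominant xW; have e0 := eps_gt0 R m.
have : eps R m * #|W|.-1%:R <= eps R m * #|W|%:R by rewrite ler_wpM2l ?ler_nat ?leq_pred // ltW.
lra.
Qed.

Lemma card_part_prod : #|[set f : {ffun 'I_k -> T} | [forall i, f i \in part i]]| =
  (\prod_i #|part i|)%N.
Proof. exact: card_family_prod. Qed.

(** A transversal of the parts through a bad pair is not a copy, and each bad pair extends to a
    transversal by free choices in the other parts. *)
Lemma transversal_copies_bad i j : i != j ->
  (#|transversal_copies| + #|bad_pairs i j| * \prod_(l | (l != i) && (l != j)) #|part l|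
     <= \prod_l #|part l|)%N.
Proof.
move=> ij; rewrite -card_part_prod.
set tr := [set f | _].
pose B := [set f in tr | (f i, f j) \in bad_pairs i j].
have BE f : (f \in B) = [forall l, f l \in part l] && ((f i, f j) \in bad_pairs i j).
  by rewrite in_set in_set.
have -> : (#|bad_pairs i j| * \prod_(l | (l != i) && (l != j)) #|part l|)%N = #|B|.
  rewrite -[RHS]sum1_card (partition_big (fun f : {ffun 'I_k -> T} => (f i, f j)) (mem (bad_pairs i j))) /=; last first.
    by move=> f; rewrite inE => /andP[].
  rewrite -sum_nat_const; apply: eq_bigr => -[x y] xyB.
  rewrite -(card_pinned_family part x y ij) -sum1_card; apply: eq_bigl => f.
  rewrite BE in_set; apply/forallP/andP.
    move=> h; have := h i; have := h j.
    rewrite eqxx [j == i]eq_sym (negPf ij) eqxx !inE => /eqP fj /eqP fi.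
    rewrite fi fj eqxx; split => //; apply/andP; split; last by move: xyB; rewrite !inE.
    apply/forallP => l; have := h l.
    move: xyB; rewrite inE /= => /and3P[xi yj _].
    case: eqVneq => [->|_]; first by rewrite fi.
    by case: eqVneq => [->|_] //; rewrite fj.
  case=> /andP[/forallP h _] /eqP[fi fj] l.
  case: eqVneq => [->|_]; first by rewrite inE fi.
  by case: eqVneq => [->|_] //; rewrite inE fj.
have dis : [disjoint transversal_copies & B].
  apply/pred0P => f; rewrite !inE /=; apply/negP.
  case/andP => /andP[/andP[/role_copyP cf _] _] /andP[_ /and3P[_ _]].
  by rewrite cf.
rewrite -[leqLHS]subn0 -(cards0 {ffun 'I_k -> T}) -(disjoint_setI0 dis) -cardsU.
apply: subset_leq_card; apply/subsetP => f; rewrite !inE => /orP[|/andP[]//].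
by move=> /andP[/andP[_ /forallP fW] /forallP rf]; apply/forallP => l; rewrite inE fW rf.
Qed.

Lemma mixed_nonfixed f : f \in mixed_copies ->
  [/\ f \in role_copies W, exists a, r (f a) != a & forall c, exists b, r (f b) != c].
Proof.
rewrite inE => /andP[fW /andP[/forallPn ex /forallP all]]; split=> // c.
by have /existsP := all c.
Qed.

Lemma copies_split :
  (#|role_copies W| <= #|transversal_copies| + \sum_c #|role_copies (part c)| + #|mixed_copies|)%N.
Proof.
have sub : role_copies W \subset
    transversal_copies :|: (\bigcup_c role_copies (part c)) :|: mixed_copies.
  apply/subsetP => f fW; rewrite !in_setU; case: (boolP (f \in mixed_copies)); first by rewrite orbT.
  rewrite orbF; rewrite inE fW /= negb_and negbK; case/orP => [h|].
    by rewrite inE fW h.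
  case/forallPn => c /existsPn h; apply/orP; right; apply/bigcupP; exists c => //.
  have /role_copiesP[cf fW'] := fW; apply/role_copiesP; split => // i.
  by rewrite inE fW'; have := h i; rewrite negbK.
apply: leq_trans (subset_leq_card sub) _.
apply: leq_trans (leq_card_setU _ _) _; rewrite leq_add2r.
apply: leq_trans (leq_card_setU _ _) _; rewrite leq_add2l.
exact: card_bigcup_le.
Qed.

(** A mixed copy has a vertex [x] in a non-dominant role. The bounds for the various such roles of
    [x] are [(k - 1)]-th powers, so they add up to at most the power of their summed bases, and
    these roles share only [eps * n] edges. *)
Lemma mixed_copies_vertex :
  (#|mixed_copies|%:R : R) <= #|W|%:R * (eps R m * #|W|%:R / m.+1%:R) ^+ m.+1.
Proof.
have le1 : (#|mixed_copies| <=
    \sum_(x in W) \sum_(i | i != r x) #|[set f in role_copies W | f i == x]|)%N.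
  rewrite pair_big_dep /=; apply: leq_trans (card_bigcup_le _ _).
  apply: subset_leq_card; apply/subsetP => f /mixed_nonfixed[fW [a ra] _].
  apply/bigcupP; exists (f a, a) => /=; last by rewrite inE fW eqxx.
  by have /role_copiesP[_ ->] := fW; rewrite eq_sym.
rewrite -(ler_nat R) in le1; apply: le_trans le1 _.
rewrite natr_sum mulr_natl -sumr_const; apply: ler_sum => x xW.
have nd := nondominant_degree xW.
pose p i : R := (role_degree W x i)%:R / m.+1%:R.
have p0 i : 0 <= p i by rewrite divr_ge0 ?ler0n.
have sp : \sum_(i | i != r x) p i <= eps R m * #|W|%:R / m.+1%:R.
  by rewrite -mulr_suml ler_wpM2r // invr_ge0 ler0n.
rewrite natr_sum; apply: le_trans (_ : \sum_(i | i != r x) p i ^+ m.+1 <= _).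
  by apply: ler_sum => i _; exact: copies_vertex_le.
have s0 : 0 <= \sum_(i | i != r x) p i by exact: sumr_ge0.
apply: le_trans (_ : (\sum_(i | i != r x) p i) ^+ m.+1 <= _); last first.
  by rewrite lerXn2r ?nnegrE // (le_trans s0).
rewrite [leRHS]exprSr; apply: (@sum_expn_le_max _ _ [pred i | i != r x]) => // i /= ir.
by rewrite (bigD1 i) //= lerDl sumr_ge0.
Qed.

Definition cross_pairs f : {set 'I_k * 'I_k} :=
  [set p | (r (f p.1) != r (f p.2)) && ~~ ((r (f p.1) == p.1) && (r (f p.2) == p.2))].

Definition all_bad_pairs : {set T * T} :=
  [set e | [&& e.1 \in W, e.2 \in W, r e.1 != r e.2 & ~~ L e.1 e.2 (r e.1) (r e.2)]].

(** The label of [e] determines the pair of roles [p0]. One end of [e] plays a non-dominant role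
    there, hence has role degree at most [eps * n], and AM-GM over the [m] other roles bounds the
    copies. *)
Lemma mixed_copies_through (e : T * T) :
  (#|[set fp : {ffun 'I_k -> T} * ('I_k * 'I_k) |
      [&& fp.1 \in role_copies W, fp.2 \in cross_pairs fp.1 &
          (fp.1 fp.2.1, fp.1 fp.2.2) == e]]|%:R : R)
    <= (eps R m * #|W|%:R / m%:R) ^+ m.
Proof.
set X := [set fp | _].
have e0 : 0 <= eps R m * #|W|%:R / m%:R.
  by rewrite divr_ge0 ?ler0n // mulr_ge0 ?ler0n // ltW ?eps_gt0.
have [->|[[f0 p0] h0]] := set_0Vmem X.
  by rewrite cards0 exprn_ge0.
have LX fp : fp \in X -> L e.1 e.2 fp.2.1 fp.2.2.
  rewrite inE => /and3P[/role_copiesP[/role_copyP cf _] + /eqP <-] /=.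
  rewrite inE => /andP[+ _]; move=> h; apply: cf; apply: contraNneq h => ->.
  by rewrite eqxx.
have pE fp : fp \in X -> fp.2 = p0.
  move=> /LX h; have [h1 h2] := L_uniq h (LX _ h0).
  by rewrite [LHS]surjective_pairing h1 h2 -surjective_pairing.
have pij : p0.1 != p0.2 by exact: L_role (LX _ h0).
have le1 : (#|X| <= #|[set f in role_copies W | (f p0.1 == e.1) && (f p0.2 == e.2)]|)%N.
  have inj : {in X &, injective fst}.
    by move=> [f p] [f' p'] /pE /= -> /pE /= -> ->.
  rewrite -(card_in_imset inj) subset_leq_card //.
  apply/subsetP => _ /imsetP[[f p] h ->] /=; have := pE _ h => /= pp.
  by move: h; rewrite !inE /= pp => /and3P[-> _ /eqP <-]; rewrite !eqxx.
have main x y i j : x \in W -> i != j -> r x != i ->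
    (#|[set f in role_copies W | (f i == x) && (f j == y)]|%:R : R) <= (eps R m * #|W|%:R / m%:R) ^+ m.
  move=> xW ij rx; apply: le_trans (copies_edge_le W x y ij) _.
  rewrite lerXn2r ?nnegrE ?e0 ?divr_ge0 ?ler0n //.
  rewrite ler_wpM2r ?invr_ge0 ?ler0n //; apply: le_trans (nondominant_degree xW).
  by rewrite (bigD1 i) 1?eq_sym //= lerDl sumr_ge0.
rewrite -(ler_nat R) in le1; apply: le_trans le1 _.
move: h0; rewrite inE /= => /and3P[/role_copiesP[_ fW]].
rewrite inE => /andP[_]; rewrite negb_and => h /eqP <- /=.
case/orP: h => h; first exact: main.
have := main _ (f0 p0.1) _ p0.1 (fW p0.2) _ h; rewrite eq_sym => /(_ pij).
by under eq_finset => f do rewrite [X in _ && X]andbC.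
Qed.

Lemma card_all_bad_pairs : (#|all_bad_pairs| <= \sum_(p | p.1 != p.2) #|bad_pairs p.1 p.2|)%N.
Proof.
apply: leq_trans (card_bigcup_le _ _); apply: subset_leq_card; apply/subsetP => e.
rewrite inE => /and4P[e1 e2 re nL]; apply/bigcupP; exists (r e.1, r e.2) => //.
by rewrite !inE e1 e2 !eqxx.
Qed.

(** Double counting of mixed copies and bad pairs between parts: each mixed copy contains at least
    [2 * m] ordered ones by [card_non_fixed_cross_pairs], and [i], [j] is the choice with the most
    bad pairs among the [k * (k - 1)] ordered choices of roles. *)
Lemma mixed_copies_edge : exists i j, i != j /\
  (#|mixed_copies|%:R : R) <= #|bad_pairs i j|%:R *
     (m.+2%:R * m.+1%:R / 2 / m%:R * (eps R m * #|W|%:R / m%:R) ^+ m).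
Proof.
pose p0 : 'I_k * 'I_k := (ord0, ord_max).
have [[i j] /= ij imax] := @arg_maxnP _ p0 (fun p => p.1 != p.2) (fun p => #|bad_pairs p.1 p.2|) isT.
exists i, j; split => //.
set C := (_ / _) ^+ m.
have C0 : 0 <= C.
  by rewrite exprn_ge0 // divr_ge0 ?ler0n // mulr_ge0 ?ler0n // ltW ?eps_gt0.
have y0 : (0 : R) < m%:R by rewrite ltr0n; lia.
have bads : (#|all_bad_pairs| <= m.+2 * m.+1 * #|bad_pairs i j|)%N.
  apply: leq_trans card_all_bad_pairs _.
  have -> : (m.+2 * m.+1 = #|[pred p : 'I_k * 'I_k | p.1 != p.2]|)%N.
    rewrite -sum1_card -(pair_big_dep xpredT (fun a b : 'I_k => a != b) (fun _ _ => 1%N)) /=.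
    under eq_bigr => a _ do (rewrite sum1_card (eq_card (B := predC1 a)) ?cardC1 ?card_ord;
      last by move=> b; rewrite !inE eq_sym).
    by rewrite sum_nat_const card_ord.
  by rewrite -sum_nat_const; apply: leq_sum => p; exact: imax.
have count : ((2 * m) * #|mixed_copies| <= \sum_(e in all_bad_pairs)
    #|[set fp : {ffun 'I_k -> T} * ('I_k * 'I_k) | [&& fp.1 \in role_copies W,
       fp.2 \in cross_pairs fp.1 & (fp.1 fp.2.1, fp.1 fp.2.2) == e]]|)%N.
  apply: (@leq_trans (\sum_(f in mixed_copies) #|cross_pairs f|)).
    rewrite mulnC -sum_nat_const; apply: leq_sum => f /mixed_nonfixed[_ ex all].
    exact: (@card_non_fixed_cross_pairs m (fun a => r (f a))).
  under eq_bigr => f _ do rewrite -sum1_card.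
  rewrite pair_big_dep /=.
  rewrite (partition_big (fun fp : {ffun 'I_k -> T} * ('I_k * 'I_k) =>
     (fp.1 fp.2.1, fp.1 fp.2.2)) (mem all_bad_pairs)) /=.
    apply: leq_sum => e _; rewrite sum1_card subset_leq_card //.
    apply/subsetP => fp; rewrite unfold_in => /andP[/andP[/mixed_nonfixed[fW _ _] pf] /eqP <-].
    by rewrite in_set fW pf eqxx.
  move=> [f p] /= /andP[/mixed_nonfixed[fW _ _] pf].
  have /role_copiesP[/role_copyP cf fW'] := fW.
  move: pf; rewrite inE => /andP[cr nfix]; rewrite inE /= !fW' cr /=.
  apply: contra nfix => h.
  have pp : p.1 != p.2 by apply: contraNneq cr => ->.
  by have [<- <-] := L_uniq (cf _ _ pp) h; rewrite !eqxx.
have main : (2 * m%:R) * #|mixed_copies|%:R <= (m.+2%:R * m.+1%:R * #|bad_pairs i j|%:R) * C.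
  rewrite -(ler_nat R) !natrM natr_sum in count; apply: le_trans count _.
  apply: le_trans (_ : #|all_bad_pairs|%:R * C <= _).
    by rewrite mulr_natl -sumr_const; apply: ler_sum => e _; exact: mixed_copies_through.
  by rewrite ler_wpM2r // -!natrM ler_nat.
have F (b K z y c : R) : 0 < y -> b * (K * z / 2 / y * c) = K * z * b * c / (2 * y).
  by move=> hy; field; rewrite gt_eqF.
rewrite F //.
by rewrite ler_pdivlMr ?mulr_gt0 // mulrC.
Qed.

(** Dividing part sizes by [n], bad pairs by [n ^ 2] and mixed copies by [n ^ k] reduces the count
    to [part_sizes_bound]; the power sum there pays for the copies inside the parts. *)
Lemma dominant_copies_bound :
  (forall c, ((k ^ k - k) * #|role_copies (part c)| <= #|part c| ^ k)%N) ->
  ((k ^ k - k) * #|role_copies W| <= #|W| ^ k)%N.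
Proof.
move=> IH; set M := (k ^ k - k)%N.
have n0 : (0 : R) < #|W|%:R by rewrite ltr0n (leq_trans _ W_ge).
have [i [j [ij mixE]]] := mixed_copies_edge.
have mixV := mixed_copies_vertex.
pose n : R := #|W|%:R; rewrite -/n in n0 mixE mixV.
pose x c : R := #|part c|%:R / n.
pose e : R := #|bad_pairs i j|%:R / n ^+ 2.
pose mu : R := #|mixed_copies|%:R / n ^+ k.
have e0 := eps_gt0 R m.
have x0 c : 0 <= x c by rewrite divr_ge0 ?ler0n // ltW.
have sumx : \sum_c x c = 1.
  rewrite -mulr_suml -natr_sum; have -> : (\sum_c #|part c| = #|W|)%N; last by rewrite divff ?gt_eqF.
  rewrite -[RHS]sum1_card (partition_big r predT) //=; apply: eq_bigr => c _.
  by rewrite -sum1_card; apply: eq_bigl => y; rewrite inE.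
have xcap c : x c <= 2 * eps R m + (1 - 2 * eps R m) / m.+2%:R.
  have e1 := eps_le R m_ge2.
  apply: le_trans (_ : 2 * eps R m + (1 - 2 * eps R m) / n <= _).
    rewrite ler_pdivrMr // mulrDl divfK ?gt_eqF //.
    have := part_cap c; have -> : n = #|W|.-1%:R + 1 by rewrite natr1 prednK // (leq_trans _ W_ge).
    lra.
  rewrite lerD2l ler_wpM2l //; first lra.
  by rewrite lef_pV2 ?posrE ?n0 ?ltr0n // ler_nat.
have ee0 : 0 <= e by rewrite divr_ge0 ?ler0n ?exprn_ge0 // ltW.
have kE : n ^+ k = n ^+ 2 * n ^+ m by rewrite -exprD.
have mue : mu <= e * edge_coef R m.
  rewrite /mu /e ler_pdivrMr ?exprn_gt0 //; apply: le_trans mixE _.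
  rewrite kE /edge_coef -/n (_ : eps R m * n / m%:R = eps R m / m%:R * n); last by rewrite mulrAC.
  have F (a b K z c d y : R) : a != 0 -> y != 0 ->
    d * (K * z / 2 / y * (c * b)) = d / a * (K * z / 2 / y * c) * (a * b).
    by move=> a0 hy; field; rewrite hy a0.
  have y0 : (m%:R : R) != 0 by rewrite pnatr_eq0; lia.
  by rewrite exprMn (F (n ^+ 2)) // gt_eqF // exprn_gt0.
have muv : mu <= vertex_coef R m.
  rewrite /mu ler_pdivrMr ?exprn_gt0 //; apply: le_trans mixV _.
  rewrite /vertex_coef -/n (_ : eps R m * n / m.+1%:R = eps R m / m.+1%:R * n); last by rewrite mulrAC.
  by rewrite exprMn (exprS n m.+1) mulrCA.
have := @part_sizes_bound R m x i j e mu m_ge2 x0 sumx xcap ij ee0 mue muv.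
set P := \prod_l x l; set Q := \prod_(l | _ && _) x l.
have PE : P * n ^+ k = (\prod_l #|part l|)%:R.
  by rewrite natr_prod /P big_split /= prodr_const card_ord exprVn mulfVK // gt_eqF // exprn_gt0.
have QE : e * Q * n ^+ k = (#|bad_pairs i j| * \prod_(l | (l != i) && (l != j)) #|part l|)%:R.
  rewrite natrM natr_prod /Q big_split /= (prodr_const [pred l | (l != i) && (l != j)]).
  rewrite card_predC2 // exprVn kE /e.
  have F (a b c d : R) : a != 0 -> b != 0 -> c / a * (d / b) * (a * b) = c * d.
    by move=> a0 b0; field; rewrite b0 a0.
  by rewrite F // gt_eqF // exprn_gt0.
have muE : mu * n ^+ k = #|mixed_copies|%:R by rewrite /mu divfK // gt_eqF // exprn_gt0.
have SE : (\sum_l x l ^+ m.+2) * n ^+ k = \sum_l #|part l|%:R ^+ k.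
  rewrite mulr_suml; apply: eq_bigr => l _; rewrite /x -exprMn divfK //.
  by rewrite gt_eqF.
rewrite -(ler_pM2r (exprn_gt0 k n0)) mul1r mulrDl SE -mulrA mulrDl mulrBl PE QE muE => num.
have tb := transversal_copies_bad ij; rewrite -(ler_nat R) natrD in tb.
have sp := copies_split; rewrite -(ler_nat R) !natrD natr_sum in sp.
have IHs : M%:R * \sum_c #|role_copies (part c)|%:R <= \sum_l #|part l|%:R ^+ k :> R.
  by rewrite mulr_sumr; apply: ler_sum => c _; rewrite -natrM -natrX ler_nat.
rewrite -(ler_nat R) natrM natrX; apply: le_trans num.
apply: le_trans (ler_wpM2l (ler0n R M) sp) _.
have F (a tc sc mx p bq q : R) : a * sc <= q -> a * (tc + bq) <= a * p ->
    a * (tc + sc + mx) <= a * (p - bq + mx) + q by move=> *; lra.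
exact: F IHs (ler_wpM2l (ler0n R M) tb).
Qed.

End DominantRoles.

Theorem role_copies_bound (W : {set T}) : (2 <= m)%N ->
  ((k ^ k - k) * #|role_copies W| <= #|W| ^ k)%N.
Proof.
move=> m2; have [n] := ubnP #|W|; elim: n W => // n IHn W Wn.
have [small|big] := ltnP #|W| k.
  have -> : role_copies W = finset.set0.
    apply/setP => f; rewrite in_set0; apply/negP => /role_copies_card.
    by rewrite leqNgt small.
  by rewrite cards0 muln0.
pose dg x := #|[set f in role_copies W | [exists i, f i == x]]|.
have W0 : (0 < #|W|)%N by rewrite (leq_trans _ big).
(* The threshold is exactly what the bound loses when one vertex is deleted. *)
case: (boolP [exists x in W, ((k ^ k - k) * dg x <= #|W| ^ k - #|W|.-1 ^ k)%N]).
  case/existsP => x /andP[xW dx].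
  have cW : #|W :\ x| = #|W|.-1 by rewrite (cardsD1 x W) xW.
  have le1 : (#|role_copies W| <= #|role_copies (W :\ x)| + dg x)%N.
    apply: leq_trans (leq_card_setU _ _); apply: subset_leq_card; apply/subsetP => f fW.
    rewrite in_setU; apply/orP; case: (boolP [exists i, f i == x]) => [fx|/existsPn fx].
      by right; rewrite in_set fW fx.
    have /role_copiesP[cf fW'] := fW; left; apply/role_copiesP; split => // i.
    by rewrite !inE fW' fx.
  have : ((k ^ k - k) * #|role_copies (W :\ x)| <= #|W|.-1 ^ k)%N.
    by rewrite -cW; apply: IHn; rewrite cW; lia.
  have : (#|W|.-1 ^ k <= #|W| ^ k)%N by rewrite leq_exp2r // leq_pred.
  move: dx (leq_mul (leqnn (k ^ k - k)%N) le1); rewrite mulnDr; lia.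
move=> /existsPn deg_big.
(* By [rP], the default [ord0] is never taken on [W]. *)
pose r x := odflt ord0 [pick i | (1 - eps R m) * #|W|.-1%:R < (role_degree W x i)%:R].
have rP x : x \in W -> (1 - eps R m) * #|W|.-1%:R < (role_degree W x (r x))%:R.
  move=> xW; rewrite /r; case: pickP => //= none.
  suff [i] : exists i, (1 - eps R m) * #|W|.-1%:R < (role_degree W x i)%:R by rewrite none.
  have e0 := eps_gt0 R m; have e1 := eps_le R m2.
  apply: (@dominant_summand R _ _ m) => //.
  - by apply/andP; split; lra.
  - by rewrite -natr_sum ler_nat sum_role_degree.
  have Mk : (0 < k ^ k - k)%N by rewrite subn_gt0 expn_self_gt.
  have M0 : (0 : R) < (k ^ k - k)%:R by rewrite ltr0n.
  have z0 : (0 : R) < m.+1%:R ^+ m.+1 by rewrite exprn_gt0 ?ltr0n.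
  have dle : (dg x)%:R <= (\sum_i (role_degree W x i)%:R ^+ m.+1) / m.+1%:R ^+ m.+1 :> R.
    rewrite mulr_suml; apply: le_trans (_ : \sum_i #|[set f in role_copies W | f i == x]|%:R <= _).
      rewrite -natr_sum ler_nat; apply: leq_trans (card_bigcup_le _ _).
      apply: subset_leq_card; apply/subsetP => f; rewrite inE => /andP[fW /existsP[i fi]].
      by apply/bigcupP; exists i => //; rewrite inE fW fi.
    by apply: ler_sum => i _; rewrite -expr_div_n; exact: copies_vertex_le.
  have := deg_big x; rewrite xW /= -ltnNge => dbig.
  (* The threshold is at least [k * (n - 1) ^ (k - 1)], the form in which [dominance_threshold]
     applies. *)
  have := expn_succ_ge #|W|.-1 m.+1; rewrite prednK // => exp.
  have {}dbig : (k * #|W|.-1 ^ m.+1 < (k ^ k - k) * dg x)%N.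
    by apply: leq_ltn_trans dbig; rewrite leq_subRL ?leq_exp2r ?leq_pred.
  rewrite -(ltr_nat R) !natrM natrX in dbig.
  rewrite ler_pdivlMr // in dle.
  have thr := dominance_threshold R m2.
  have N0 : 0 <= (#|W|.-1%:R : R) ^+ m.+1 by rewrite exprn_ge0 ?ler0n.
  rewrite -(ltr_pM2r M0).
  apply: le_lt_trans (_ : m.+1%:R ^+ m.+1 * m.+2%:R * #|W|.-1%:R ^+ m.+1 < _).
    by rewrite mulrAC ler_wpM2r.
  apply: lt_le_trans (_ : (k ^ k - k)%:R * (dg x)%:R * m.+1%:R ^+ m.+1 <= _).
    by rewrite -mulrA mulrC ltr_pM2r.
  by rewrite mulrC mulrA [leRHS]mulrC [_ * (k ^ k - k)%:R]mulrC -mulrA ler_pM2l // mulrC.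
apply: (@dominant_copies_bound W r) => // c; apply: IHn.
apply: leq_trans (_ : #|W| <= n)%N; last by [].
(* Every part is smaller than [W], because [2 * eps < 1]. *)
rewrite -(ltr_nat R); apply: le_lt_trans (part_cap m2 big rP c) _.
have -> : #|W|%:R = #|W|.-1%:R + 1 :> R by rewrite natr1 prednK.
have e0 := eps_gt0 R m; have e1 := eps_le R m2.
have w0 : (0 : R) < #|W|.-1%:R by rewrite ltr0n; lia.
rewrite ltrD2r -[ltRHS]mul1r ltr_pM2r //; lra.
Qed.

End Roles.

(** * Coloured tournaments as role labellings *)

Definition plays k s (R : ctour k k) (H : ctour s k) (x y : 'I_s) (i j : 'I_k) : bool :=
  [&& x != y, i != j, H.1 (x, y) == R.1 (i, j) & H.2 (x, y) == R.2 (i, j)].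

Lemma ctourP n k (T : ctour n k) (x y : 'I_n) : is_ctour T -> x != y ->
  T.1 (y, x) = ~~ T.1 (x, y) /\ T.2 (y, x) = T.2 (x, y).
Proof.
move=> /forallP/(_ x)/forallP/(_ y) + /negPf xy; rewrite xy => /and3P[+ /eqP -> _].
by case: (T.1 (x, y)); case: (T.1 (y, x)).
Qed.

Lemma ctour_diag n k (T : ctour n k) (x : 'I_n) : is_ctour T ->
  T.1 (x, x) = false /\ T.2 (x, x) = set0.
Proof.
by move=> /forallP/(_ x)/forallP/(_ x); rewrite eqxx => /andP[/negPf -> /eqP ->].
Qed.

(* In [is_copy], [setT] is the full set of [classical_sets], not of [finset]. *)
Import (canonicals) classical_sets.

Lemma imset_classical_setT (S T : finType) (f : S -> T) :
  f @: (@classical_sets.setT S) = f @: [set: S].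
Proof.
apply/setP => y; apply/imsetP/imsetP => -[x _ ->]; exists x; rewrite ?inE //.
exact: classical_sets.mem_set.
Qed.

Section Plays.
Variables (m s : nat).
Let k := m.+2.
Variables (R : ctour k k) (H : ctour s k).
Hypotheses (ctR : is_ctour R) (rainbowR : rainbow R) (ctH : is_ctour H).

Lemma plays_vertex x y i j : plays R H x y i j -> x != y.
Proof. by case/and4P. Qed.

Lemma plays_role x y i j : plays R H x y i j -> i != j.
Proof. by case/and4P. Qed.

Lemma plays_sym x y i j : plays R H x y i j = plays R H y x j i.
Proof.
rewrite /plays eq_sym [j == i]eq_sym; case: (eqVneq y x) => //= yx; case: (eqVneq i j) => //= ij.
have [-> ->] := ctourP ctH yx; have [-> ->] := ctourP ctR ij.
by congr andb; case: (H.1 _); case: (R.1 _).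
Qed.

(** The rainbow colouring determines the unordered pair of roles, and the orientation rules out the
    exchange of its two members. *)
Lemma plays_uniq x y i j i' j' :
  plays R H x y i j -> plays R H x y i' j' -> i = i' /\ j = j'.
Proof.
move=> /and4P[_ ij /eqP h1 /eqP h2] /and4P[_ ij' /eqP h1' /eqP h2'].
have E : [set i; j] = [set i'; j'] by apply: rainbowR => //; rewrite -h2 -h2'.
have /setP/(_ i) := E; rewrite !inE eqxx /= => /esym/orP[/eqP ii|/eqP ij0].
  have /setP/(_ j) := E; rewrite !inE eqxx orbT /= => /esym/orP[/eqP ji|/eqP //].
  by move: ij; rewrite ii ji eqxx.
have /setP/(_ j) := E; rewrite !inE eqxx orbT /= => /esym/orP[/eqP ji|/eqP jj].
  have [h _] := ctourP ctR ij'; move: h1; rewrite ij0 ji h -h1'.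
  by case: (H.1 _).
by move: ij; rewrite ij0 jj eqxx.
Qed.

(** With a second role [j], the edge from [f i] to [f j] also lies in the copy [g], and its label
    tells which role [f i] plays there. *)
Lemma role_copy_image_inj (f g : {ffun 'I_k -> 'I_s}) :
  role_copy (plays R H) f -> role_copy (plays R H) g -> f @: setT = g @: setT -> f = g.
Proof.
move=> /role_copyP cf /role_copyP cg E; apply/ffunP => i.
have mem a : exists b, f a = g b.
  have /imsetP[b _ ->] : f a \in g @: setT by rewrite -E imset_f.
  by exists b.
have [a fa] := mem i.
have [j ij] : exists j : 'I_k, i != j.
  by have [->|i0] := eqVneq i ord0; [exists ord_max|exists ord0].
have [b fb] := mem j; have h := cf _ _ ij.
have ab : a != b.
  by apply: contraTneq (plays_vertex h) => e; rewrite fa fb e eqxx.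
have := cg _ _ ab; rewrite -fa -fb => h'.
by have [e _] := plays_uniq h h'; rewrite fa -e.
Qed.

Lemma ncopiesE : ncopies R H = #|role_copies (plays R H) [set: 'I_s]|.
Proof.
rewrite /ncopies -[RHS](card_in_imset (f := fun f : {ffun 'I_k -> 'I_s} => f @: setT)).
  apply: eq_card => K; rewrite !inE; apply/idP/imsetP.
    case/andP => _ /existsP[f /and3P[/injectiveP f_inj + /forallP cf]].
    rewrite imset_classical_setT => /eqP fK.
    exists f; last by rewrite fK.
    apply/role_copiesP; split => [|i]; last by rewrite inE.
    apply/role_copyP => i j ij; rewrite /plays (inj_eq f_inj) ij /=.
    by have /forallP/(_ j) := cf i; rewrite ij.
  move=> [f /role_copiesP[cf _] ->].
  have f_inj := role_copy_inj plays_vertex cf.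
  apply/andP; split; first by rewrite card_imset // cardsT card_ord.
  apply/existsP; exists f; rewrite imset_classical_setT eqxx /=; apply/andP; split; first exact/injectiveP.
  apply/forallP => i; apply/forallP => j; apply/implyP => ij.
  by have /role_copyP/(_ i j ij)/and4P[_ _ -> ->] := cf.
by move=> f g /role_copiesP[cf _] /role_copiesP[cg _]; exact: role_copy_image_inj.
Qed.

Lemma ncopies_upper : (2 <= m)%N -> ((k ^ k - k) * ncopies R H <= s ^ k)%N.
Proof.
move=> m2; rewrite ncopiesE -[X in (_ <= X ^ _)%N]card_ord -cardsT.
(* The estimates hold over any ordered field; the rationals serve for this statement about
   integers. *)
exact: (role_copies_bound plays_vertex plays_role plays_sym plays_uniq rat).
Qed.

End Plays.

(** * The iterated blow-up *)

Section Blowup.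
Variable m : nat.
Let k := m.+2.

Definition digit (l x : nat) : 'I_k := Ordinal (ltn_pmod (x %/ k ^ l) (ltn0Sn m.+1)).

Lemma digit_div l x : digit l (x %/ k) = digit l.+1 x.
Proof. by apply: val_inj; rewrite /= expnS divnMA. Qed.

Lemma digit_inj t x y : x < k ^ t -> y < k ^ t ->
  (forall l, l < t -> digit l x = digit l y) -> x = y.
Proof.
elim: t x y => [|t IH] x y; first by rewrite expn0; lia.
rewrite expnSr => xk yk dxy; rewrite (divn_eq x k) (divn_eq y k).
have -> : x %/ k = y %/ k.
  by apply: IH; rewrite ?ltn_divLR // => l lt; rewrite !digit_div dxy.
by have := congr1 val (dxy 0 (ltn0Sn t)); rewrite /= expn0 !divn1 => ->.
Qed.

Section Level.
Variable s : nat.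

(** Searching [s] positions is enough, since integers below [s] have at most [s] digits in base [k].
    Equal arguments get the value [s]. *)
Definition level (x y : nat) : nat := find (fun l => digit l x != digit l y) (iota 0 s).

Lemma level_sym x y : level x y = level y x.
Proof. by apply: eq_find => l; rewrite eq_sym. Qed.

Lemma level_neq x y : x < s -> y < s -> x != y ->
  digit (level x y) x != digit (level x y) y.
Proof.
move=> xs ys xy.
have h : has (fun l => digit l x != digit l y) (iota 0 s).
  apply: contraNT xy => /hasPn h; apply/eqP; apply: (@digit_inj s).
  - exact: ltn_trans xs (ltn_expl _ _).
  - exact: ltn_trans ys (ltn_expl _ _).
  by move=> l ls; apply/eqP; have := h l; rewrite mem_iota ls negbK; apply.
have := nth_find 0 h; rewrite nth_iota //.
by move: h; rewrite has_find size_iota.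
Qed.

Lemma level_eq x y l : l < s -> (forall l', l' < l -> digit l' x = digit l' y) ->
  digit l x != digit l y -> level x y = l.
Proof.
move=> ls low dl; apply/eqP; rewrite eqn_leq; apply/andP; split.
  rewrite leqNgt; apply: contra dl => lt.
  by have := before_find 0 lt; rewrite nth_iota // add0n => /negbFE.
rewrite leqNgt; apply/negP => lt.
have h : has (fun l => digit l x != digit l y) (iota 0 s).
  by rewrite has_find size_iota (ltn_trans lt ls).
have := nth_find 0 h; rewrite nth_iota ?(ltn_trans lt ls) // add0n -/(level x y).
by rewrite low ?eqxx.
Qed.

(* Blow-up of [R] iterated infinitely often, on the integers below [s]: an
   edge is a copy of the edge of [R] given by the lowest base-[k] digits at
   which its ends differ. *)
Definition blowup (R : ctour k k) : ctour s k :=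
  ([ffun p : 'I_s * 'I_s => R.1 (digit (level p.1 p.2) p.1, digit (level p.1 p.2) p.2)],
   [ffun p : 'I_s * 'I_s => R.2 (digit (level p.1 p.2) p.1, digit (level p.1 p.2) p.2)]).

Lemma blowup_ctour R : is_ctour R -> is_ctour (blowup R).
Proof.
move=> ctR; apply/forallP => x; apply/forallP => y; rewrite /= !ffunE /=.
case: (eqVneq x y) => [->|xy].
  (* On the diagonal the two digits agree, so the normalised diagonal of [R] is inherited. *)
  by have [-> ->] := ctour_diag (digit (level y y) y) ctR; rewrite eqxx.
rewrite [level y x]level_sym; have := level_neq (ltn_ord x) (ltn_ord y) xy.
move: (digit _ x) (digit _ y) => i j /negPf ij.
by move/forallP: ctR => /(_ i)/forallP/(_ j); rewrite ij.
Qed.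

Lemma plays_blowup R (x y : 'I_s) l : l < s ->
  (forall l', l' < l -> digit l' x = digit l' y) -> digit l x != digit l y ->
  plays R (blowup R) x y (digit l x) (digit l y).
Proof.
move=> ls low dl; rewrite /plays dl /= !ffunE /= (level_eq ls low dl) !eqxx !andbT.
by apply: contraNneq dl => ->.
Qed.

Section Layer.
Variable l : nat.
Let q := s %/ k ^ l.+1.

Lemma layer_bound (w : 'I_(k ^ l)) (i : 'I_k) (c : 'I_q) :
  w + (i + c * k) * k ^ l < s.
Proof.
have : (c * k + i) < q * k by have := ltn_ord c; have := ltn_ord i; nia.
have : q * k * k ^ l <= s by rewrite -mulnA -expnS leq_trunc_div.
move: (ltn_ord w); move: (nat_of_ord w) => v; move: (k ^ l) => K; nia.
Qed.

(** All vertices share the lowest [l] digits, those of [p.1]; the digit at position [l] is the role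
    [i], and [p.2 i] gives the higher digits freely. *)
Definition layer_copy (p : 'I_(k ^ l) * {ffun 'I_k -> 'I_q}) : {ffun 'I_k -> 'I_s} :=
  [ffun i => Ordinal (layer_bound p.1 i (p.2 i))].

Lemma digit_layer p i : digit l (layer_copy p i) = i.
Proof.
apply: val_inj; rewrite /= ffunE /= addnC divnMDl ?expn_gt0 // (divn_small (ltn_ord _)) addn0.
by rewrite addnC modnMDl modn_small.
Qed.

Lemma digit_layer_low p i l' : l' < l -> digit l' (layer_copy p i) = digit l' p.1.
Proof.
move=> ll; apply: val_inj; rewrite /= ffunE /= addnC.
move: (_ + _ * k) (nat_of_ord p.1) => u v; rewrite -(subnK (ltnW ll)) expnD mulnA.
rewrite divnMDl ?expn_gt0 //.
have -> : k ^ (l - l') = k ^ (l - l').-1 * k by rewrite -expnSr prednK // subn_gt0.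
by rewrite mulnA modnMDl.
Qed.

Lemma layer_copy_inj : injective layer_copy.
Proof.
move=> [w g] [w' g'] /ffunP E.
have Ei (i : 'I_k) : w + (i + g i * k) * k ^ l = w' + (i + g' i * k) * k ^ l.
  by have := congr1 val (E i); rewrite !ffunE.
have ww : w = w'.
  apply: val_inj; have := congr1 (modn^~ (k ^ l)) (Ei ord0).
  by rewrite /= [X in X %% _]addnC [X in _ = X %% _]addnC !modnMDl !modn_small.
rewrite -ww in Ei *; congr pair; apply/ffunP => i; apply: val_inj.
have /eqP := Ei i; rewrite eqn_add2l eqn_pmul2r ?expn_gt0 // eqn_add2l eqn_pmul2r //.
by move/eqP.
Qed.

End Layer.

(** The copies that appear at depth [l] of the iteration, where their vertices first separate. *)
Definition layer (R : ctour k k) l : {set {ffun 'I_k -> 'I_s}} :=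
  [set f in role_copies (plays R (blowup R)) [set: 'I_s] |
     [forall i, digit l (f i) == i] &&
     [forall i, forall j, forall l' : 'I_l, digit l' (f i) == digit l' (f j)]].

Lemma card_layer R l : k ^ l * (s %/ k ^ l.+1) ^ k <= #|layer R l|.
Proof.
have -> : k ^ l * (s %/ k ^ l.+1) ^ k =
    #|[set: 'I_(k ^ l) * {ffun 'I_k -> 'I_(s %/ k ^ l.+1)}]|.
  by rewrite cardsT card_prod card_ffun !card_ord.
rewrite -(card_imset _ (@layer_copy_inj l)); apply: subset_leq_card.
apply/subsetP => _ /imsetP[p _ ->].
have ls : l < s.
  have q0 : 0 < s %/ k ^ l.+1 by have := ltn_ord (p.2 ord0); lia.
  rewrite divn_gt0 ?expn_gt0 // in q0.
  by apply: leq_trans q0; apply: ltnW; exact: ltn_expl.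
rewrite inE; apply/andP; split; last apply/andP; last split.
- apply/role_copiesP; split => [|i]; last by rewrite inE.
  apply/role_copyP => i j ij.
  rewrite -{2}[i](digit_layer p) -{2}[j](digit_layer p); apply: plays_blowup => //.
    by move=> l' ll; rewrite !digit_layer_low.
  by rewrite !digit_layer.
- by apply/forallP => i; rewrite digit_layer.
by apply/forallP => i; apply/forallP => j; apply/forallP => l'; rewrite !digit_layer_low.
Qed.

(** The layers are disjoint: a copy in layer [l] has distinct digits at position [l], where
    membership in a deeper layer would force equal ones. *)
Lemma sum_layers R t :
  \sum_(l < t) k ^ l * (s %/ k ^ l.+1) ^ k <=
    #|role_copies (plays R (blowup R)) [set: 'I_s]|.
Proof.
apply: (@leq_trans (\sum_(l < t) #|layer R l|)).
  by apply: leq_sum => l _; exact: card_layer.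
have order (l l' : nat) f : f \in layer R l -> f \in layer R l' -> ~~ (l < l').
  rewrite !inE => /and3P[_ /forallP h _] /and3P[_ _ /forallP h']; apply/negP => ll.
  have /forallP/(_ ord_max)/forallP/(_ (Ordinal ll)) := h' ord0.
  by rewrite /= (eqP (h _)) (eqP (h _)).
under eq_bigr => l _ do rewrite -sum1_card big_mkcond.
rewrite exchange_big /= -sum1_card [leqRHS]big_mkcond; apply: leq_sum => f _.
case: ifPn => fR; last first.
  by rewrite big1 // => l _; rewrite inE (negPf fR).
apply: leq_trans (sum_bool_le1 (P := fun l : 'I_t => f \in layer R l) _).
  by apply: leq_sum => l _; case: ifP.
move=> l l' h h'; apply: val_inj; apply/eqP; rewrite eqn_leq; apply/andP; split.
  by rewrite leqNgt; exact: order h' h.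
by rewrite leqNgt; exact: order h h'.
Qed.

End Level.

Lemma ncopies_blowup s t (R : ctour k k) : is_ctour R -> rainbow R ->
  \sum_(l < t) k ^ l * (s %/ k ^ l.+1) ^ k <= ncopies R (blowup s R).
Proof.
by move=> ctR rR; rewrite ncopiesE //; exact: sum_layers.
Qed.

End Blowup.

(** * The limit *)

From mathcomp Require Import all_classical all_reals all_analysis.
Import numFieldNormedType.Exports.

Lemma bin_fact_le_expn s k : 'C(s, k) * k`! <= s ^ k.
Proof.
rewrite bin_ffact ffact_prod -[X in _ <= _ ^ X]card_ord -prod_nat_const.
by apply: leq_prod => i _; exact: leq_subr.
Qed.

Lemma expn_le_bin_fact s k : (s - k) ^ k <= 'C(s, k) * k`!.
Proof.
rewrite bin_ffact ffact_prod -[X in _ ^ X <= _]card_ord -prod_nat_const.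
by apply: leq_prod => i _; rewrite leq_sub2l // ltnW.
Qed.

Section Limits.
Local Open Scope ring_scope.
Variable rT : realType.

Lemma bernoulli_sub n (x : rT) : 0 <= x <= 1 -> 1 - n%:R * x <= (1 - x) ^+ n.
Proof.
move=> /andP[x0 x1]; elim: n => [|n IH]; first by rewrite expr0; lra.
rewrite exprS mulrS; apply: le_trans (_ : (1 - x) * (1 - n%:R * x) <= _).
  have : 0 <= n%:R * x * x by rewrite !mulr_ge0.
  lra.
by apply: ler_wpM2l => //; lra.
Qed.

Variable m : nat.
Let k := m.+2.
Let M : rT := (k ^ k - k)%:R.
Let lim_dens : rT := (k`!)%:R / M.

Lemma M_gt0 : 0 < M.
Proof. by rewrite ltr0n subn_gt0 expn_self_gt. Qed.

Lemma lim_dens_gt0 : 0 < lim_dens.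
Proof. by rewrite divr_gt0 ?M_gt0 // ltr0n fact_gt0. Qed.

(** With [y = k ^ 2 / s], Bernoulli gives ['C(s, k) * k! >= (s - k) ^ k >= s ^ k * (1 - y)], and
    [(1 - y) * (1 + 2 * y) >= 1] for [y <= 1 / 2]. *)
Lemma copies_density_upper (s N : nat) :
  (2 * k ^ 2 <= s)%N -> ((k ^ k - k) * N <= s ^ k)%N ->
  N%:R / 'C(s, k)%:R <= lim_dens + 2 * lim_dens * (k ^ 2)%:R / s%:R :> rT.
Proof.
move=> ks NM; have M0 := M_gt0.
have ksn : (k <= s)%N by apply: leq_trans ks; nia.
have s0 : (0 : rT) < s%:R by rewrite ltr0n (leq_trans _ ksn).
have C0 : (0 : rT) < 'C(s, k)%:R by rewrite ltr0n bin_gt0.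
pose y : rT := (k ^ 2)%:R / s%:R.
have y0 : 0 <= y by rewrite divr_ge0.
have y1 : y <= 1 / 2.
  rewrite ler_pdivrMr // mulrAC mul1r ler_pdivlMr // -natrM ler_nat; lia.
have low : s%:R ^+ k * (1 - y) <= 'C(s, k)%:R * (k`!)%:R :> rT.
  rewrite -natrM; apply: le_trans (_ : ((s - k) ^ k)%:R <= _); last by rewrite ler_nat expn_le_bin_fact.
  rewrite natrX natrB //.
  have -> : s%:R - k%:R = s%:R * (1 - k%:R / s%:R) :> rT.
    by rewrite mulrBr mulr1 mulrCA divff ?mulr1 // gt_eqF.
  rewrite exprMn; apply: ler_wpM2l; first by rewrite exprn_ge0.
  have -> : y = k%:R * (k%:R / s%:R) by rewrite /y natrX expr2 mulrA.
  apply: bernoulli_sub; rewrite divr_ge0 ?ler0n //= ler_pdivrMr // mul1r ler_nat //.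
have -> : lim_dens + 2 * lim_dens * (k ^ 2)%:R / s%:R = (k`!)%:R * (1 + 2 * y) / M.
  rewrite /lim_dens /y; move: M0; move: M => a a0.
  by field; rewrite !gt_eqF.
rewrite ler_pdivrMr // mulrAC ler_pdivlMr //.
apply: le_trans (_ : s%:R ^+ k <= _); first by rewrite mulrC -natrM -natrX ler_nat.
apply: le_trans (_ : s%:R ^+ k * (1 - y) * (1 + 2 * y) <= _).
  rewrite -mulrA -[leLHS]mulr1; apply: ler_wpM2l; first by rewrite exprn_ge0 // ltW.
  nra.
have -> : (k`!)%:R * (1 + 2 * y) * 'C(s, k)%:R = 'C(s, k)%:R * (k`!)%:R * (1 + 2 * y) by ring.
by apply: ler_wpM2r => //; lra.
Qed.

Let rho : rT := k%:R / k%:R ^+ k.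

(** A geometric series of ratio [rho], whose infinite sum is the [1 / (k ^ k - k)] of the
    theorem. *)
Lemma sum_layer_weights t :
  \sum_(l < t) (k ^ l)%:R / ((k ^ l.+1)%:R ^+ k) = (1 - rho ^+ t) / M.
Proof.
have K0 : (0 : rT) < k%:R by rewrite ltr0n.
have Kk0 : (0 : rT) < k%:R ^+ k by rewrite exprn_gt0.
have M0 := M_gt0.
have ME : M = k%:R ^+ k - k%:R by rewrite /M natrB ?natrX // ltnW // expn_self_gt.
elim: t => [|t IH]; first by rewrite big_ord0 expr0 subrr mul0r.
rewrite big_ord_recr /= IH.
have -> : (k ^ t)%:R / ((k ^ t.+1)%:R ^+ k) = rho ^+ t / k%:R ^+ k :> rT.
  rewrite /rho !natrX expr_div_n -exprM mulSn exprD mulnC exprM.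
  by rewrite invfM mulrA mulrAC.
have F (a b z : rT) : a != 0 -> a - b != 0 ->
    (1 - z) / (a - b) + z / a = (1 - z * (b / a)) / (a - b).
  by move=> a0 ab0; field; rewrite a0 ab0.
by rewrite exprSr ME F // ?gt_eqF // -ME.
Qed.

Lemma rho_ge0 : 0 <= rho.
Proof. by rewrite divr_ge0 ?exprn_ge0. Qed.

Lemma rho_le_half : rho <= 1 / 2.
Proof.
rewrite ler_pdivrMr ?exprn_gt0 ?ltr0n // -natrX mulrC mulrA mulr1 ler_pdivlMr //.
rewrite -natrM ler_nat expnS leq_mul2l /=; apply: leq_trans (_ : k ^ 1 <= _)%N => //.
by rewrite leq_exp2l.
Qed.

(** Only [t] layers are used. Rounding down in [s %/ k ^ l.+1] costs each of them at most a factor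
    [1 - y], and cutting the series costs [rho ^+ t]. *)
Lemma copies_density_lower (s t N : nat) : (k <= s)%N -> (k ^ t <= s)%N ->
  (\sum_(l < t) k ^ l * (s %/ k ^ l.+1) ^ k <= N)%N ->
  lim_dens * (1 - rho ^+ t - (k * k ^ t)%:R / s%:R) <= N%:R / 'C(s, k)%:R :> rT.
Proof.
move=> ks kts sumN.
have s0 : (0 : rT) < s%:R by rewrite ltr0n (leq_trans _ ks).
have C0 : (0 : rT) < 'C(s, k)%:R by rewrite ltr0n bin_gt0.
have M0 := M_gt0; have r0 := rho_ge0; have r1 := rho_le_half.
pose y : rT := (k * k ^ t)%:R / s%:R.
have y0 : 0 <= y by rewrite divr_ge0.
have layer_le l : (l < t)%N ->
    (k ^ l)%:R / ((k ^ l.+1)%:R ^+ k) * (1 - y) * s%:R ^+ k <=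
    (k ^ l * (s %/ k ^ l.+1) ^ k)%:R :> rT.
  move=> lt; rewrite natrM -!mulrA ler_wpM2l //.
  have Kt : (k ^ l.+1 <= k ^ t)%N by rewrite leq_exp2l.
  have K0 : (0 : rT) < (k ^ l.+1)%:R by rewrite ltr0n expn_gt0.
  move: Kt K0; move: (k ^ l.+1)%N => K Kt K0; rewrite natrX.
  pose x : rT := K%:R / s%:R.
  have x01 : 0 <= x <= 1.
    by rewrite divr_ge0 //= ler_pdivrMr // mul1r ler_nat (leq_trans Kt).
  apply: le_trans (_ : K%:R ^- k * ((1 - x) ^+ k * s%:R ^+ k) <= _).
    apply: ler_wpM2l; first by rewrite invr_ge0 exprn_ge0.
    apply: ler_wpM2r; first by rewrite exprn_ge0.
    apply: le_trans (bernoulli_sub k x01); rewrite lerD2l lerN2 /y /x mulrA -natrM.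
    by rewrite ler_wpM2r ?invr_ge0 // ler_nat leq_mul2l Kt orbT.
  rewrite -exprVn -!exprMn lerXn2r ?nnegrE //.
    by case/andP: x01 => ? ?; rewrite !mulr_ge0 ?invr_ge0 // subr_ge0.
  have -> : K%:R^-1 * ((1 - x) * s%:R) = s%:R / K%:R - 1.
    have F (a b : rT) : a != 0 -> b != 0 -> a^-1 * ((1 - a / b) * b) = b / a - 1.
      by move=> a0 b0; field; rewrite a0 b0.
    by rewrite /x F // gt_eqF.
  rewrite lerBlDr natr1 ler_pdivrMr // -natrM ler_nat ltnW // ltn_ceil //.
  by rewrite -(ltr0n rT).
have sum_le : (1 - rho ^+ t) / M * (1 - y) * s%:R ^+ k <= N%:R.
  rewrite -sum_layer_weights; apply: le_trans (_ : (\sum_(l < t) k ^ l * (s %/ k ^ l.+1) ^ k)%:R <= _).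
    by rewrite natr_sum !mulr_suml; apply: ler_sum => l _; exact: layer_le.
  by rewrite ler_nat.
have Cs : 'C(s, k)%:R * (k`!)%:R <= s%:R ^+ k :> rT.
  by rewrite -natrM -natrX ler_nat bin_fact_le_expn.
have F0 : (0 : rT) < (k`!)%:R by rewrite ltr0n fact_gt0.
have rt0 : 0 <= rho ^+ t by rewrite exprn_ge0.
have rt1 : rho ^+ t <= 1 by rewrite exprn_ile1 //; lra.
rewrite ler_pdivlMr // -/y.
(* Replacing ['C(s, k) * k!] by the larger [s ^ k] needs a nonnegative factor; otherwise the claim
   is trivial. *)
have [neg|pos] := leP (1 - rho ^+ t - y) 0.
  apply: le_trans (_ : 0 <= _); last exact: ler0n.
  apply: mulr_le0_ge0; last exact: ltW.
  by apply: mulr_ge0_le0 => //; exact/ltW/lim_dens_gt0.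
apply: le_trans sum_le.
apply: le_trans (_ : (1 - rho ^+ t - y) / M * s%:R ^+ k <= _).
  have -> : lim_dens * (1 - rho ^+ t - y) * 'C(s, k)%:R =
      (1 - rho ^+ t - y) / M * ('C(s, k)%:R * (k`!)%:R) by rewrite /lim_dens; ring.
  by apply: ler_wpM2l => //; rewrite divr_ge0 // ltW.
apply: ler_wpM2r; first by rewrite exprn_ge0.
rewrite mulrAC; apply: ler_wpM2r; first by rewrite invr_ge0 ltW.
have : 0 <= rho ^+ t * y by rewrite mulr_ge0.
lra.
Qed.

Lemma density_cvg (f : nat -> rT) :
  (forall s, (2 * k ^ 2 <= s)%N ->
     f s <= lim_dens + 2 * lim_dens * (k ^ 2)%:R / s%:R) ->
  (forall s t, (k <= s)%N -> (k ^ t <= s)%N ->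
     lim_dens * (1 - rho ^+ t - (k * k ^ t)%:R / s%:R) <= f s) ->
  (f s @[s --> \oo] --> lim_dens)%classic.
Proof.
move=> upper lower; have L0 := lim_dens_gt0.
apply/cvgrPdist_le => e e0.
(* The depth is fixed before [s] grows: [rho ^+ t <= 2 ^- t <= 1 / t] makes the truncation error at
   most [e / 2]. *)
pose t := Num.bound (2 * lim_dens / e).
have rt : lim_dens * rho ^+ t <= e / 2.
  have t1 : 2 * lim_dens / e < t%:R.
    apply: archi_boundP; apply: divr_ge0; last exact: ltW.
    by apply: mulr_ge0 => //; exact: ltW.
  have t2 : (t%:R : rT) <= 2 ^+ t by rewrite -natrX ler_nat ltnW // ltn_expl.
  have r2 : rho ^+ t <= 2 ^- t.
    rewrite -exprVn lerXn2r ?nnegrE ?rho_ge0 //.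
    by have := rho_le_half; rewrite mul1r.
  apply: le_trans (ler_wpM2l (ltW L0) r2) _.
  rewrite ler_pdivrMr ?exprn_gt0 // mulrAC ler_pdivlMr // mulrC.
  rewrite -[leRHS]mulrC -ler_pdivrMr //; exact: le_trans (ltW t1) t2.
pose D : rT := lim_dens * (k * k ^ t)%:R.
pose A : rT := 2 * lim_dens * (k ^ 2)%:R.
near=> s.
have s0 : (0 : rT) < s%:R by rewrite ltr0n; near: s; exact: nbhs_infty_gt.
have sD : D / s%:R <= e / 2.
  rewrite ler_pdivrMr // mulrC -ler_pdivrMr ?divr_gt0 //; near: s; exact: nbhs_infty_ger.
have sA : A / s%:R <= e.
  rewrite ler_pdivrMr // mulrC -ler_pdivrMr //; near: s; exact: nbhs_infty_ger.
have up : f s <= lim_dens + A / s%:R by apply: upper; near: s; exact: nbhs_infty_ge.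
have lo : lim_dens * (1 - rho ^+ t - (k * k ^ t)%:R / s%:R) <= f s.
  by apply: lower; near: s; exact: nbhs_infty_ge.
rewrite ler_norml; apply/andP; split; first lra.
have DE : lim_dens * ((k * k ^ t)%:R / s%:R) = D / s%:R by rewrite mulrA.
move: lo; rewrite !mulrBr DE mulr1; lra.
Unshelve. all: by end_near.
Qed.

End Limits.

Local Open Scope classical_set_scope.

Theorem theorem3p1 (rT : realType) (k : nat) (R : ctour k k) :
  (4 <= k)%N -> is_ctour R -> rainbow R ->
  maxdens rT R s @[s --> \oo] --> ((k`!)%:R / (k ^ k - k)%:R : rT)%R.
Proof.
case: k R => [|[|m]] R // m2 ctR rR.
apply: (@density_cvg rT m) => [s ks|s t ks kts].
  apply: bigmax_le => [|H ctH].
    have L0 := lim_dens_gt0 rT m.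
    by rewrite addr_ge0 ?divr_ge0 ?mulr_ge0 // ltW.
  by apply: copies_density_upper => //; exact: ncopies_upper.
apply: le_trans (le_bigmax_cond _ _ (blowup_ctour s ctR)).
by apply: copies_density_lower => //; exact: ncopies_blowup.
Qed.
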